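(* Let $p\ge2$ be an integer, $q=e^{i\pi/p}$, and let $\overline{\mathcal U}$ be the restricted quantum group $\overline{\mathcal U}_q s\ell(2)$. The Grothendieck ring of $\overline{\mathcal U}$, with its basis of classes of the $2p$ irreducible representations $X^{\alpha}(s)$ ($\alpha=\pm1$, $1\le s\le p$), has the multiplication $$X^{\alpha}(s)\,X^{\alpha'}(s')=\sum_{\substack{s''=|s-s'|+1\\ \text{step}=2}}^{s+s'-1}\widetilde X^{\alpha\alpha'}(s''),$$ where $$\widetilde X^{\alpha}(s)=\begin{cases}X^{\alpha}(s),&1\le s\le p,\\ X^{\alpha}(2p-s)+2X^{-\alpha}(s-p),&p+1\le s\le 2p-1.\end{cases}$$ That is, under the identification $\chi^\alpha(s)\leftrightarrow X^\alpha(s)$ it coincides with the algebra $\mathfrak G_{2p}$ on the $2p$ elements $\chi^{\alpha}(s)$ defined by these same structure constants (the fusion algebra of the $(1,p)$ logarithmic conformal field theory model).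
   Context: $\overline{\mathcal U}$ is the $2p^3$-dimensional complex Hopf algebra with generators $E,F,K$, relations $E^p=F^p=0$, $K^{2p}=1$, $KEK^{-1}=q^2E$, $KFK^{-1}=q^{-2}F$, $[E,F]=\frac{K-K^{-1}}{q-q^{-1}}$, and comultiplication $\Delta(E)=1\otimes E+E\otimes K$, $\Delta(F)=K^{-1}\otimes F+F\otimes1$, $\Delta(K)=K\otimes K$, counit $\epsilon(E)=\epsilon(F)=0$, $\epsilon(K)=1$, antipode $S(E)=-EK^{-1}$, $S(F)=-KF$, $S(K)=K^{-1}$. The irreducible representations of $\overline{\mathcal U}$ are $X^{\alpha}(s)$, $\alpha=\pm1$, $1\le s\le p$: $X^\alpha(s)$ has basis $|n\rangle$, $0\le n\le s-1$, with $K|n\rangle=\alpha q^{s-1-2n}|n\rangle$, $E|n\rangle=\alpha[n][s-n]|n-1\rangle$, $F|n\rangle=|n+1\rangle$, where $|-1\rangle=|s\rangle=0$ and $[n]=\frac{q^n-q^{-n}}{q-q^{-1}}$. The Grothendieck ring is that of the category of finite-dimensional $\overline{\mathcal U}$-modules, with multiplication induced by the tensor product. ''step $=2$'' means that $s''$ runs over $|s-s'|+1,|s-s'|+3,\dots,s+s'-1$. *)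

(* Defs.v *)
From HB Require Import structures.
From mathcomp Require Import all_boot all_order all_algebra.
From mathcomp Require Import boolp reals trigo.
From mathcomp Require Import complex mxtens freeg.
From mathcomp Require Import ring.

Set Implicit Arguments.
Unset Strict Implicit.
Unset Printing Implicit Defensive.

Import Order.TTheory GRing.Theory Num.Theory.

Local Open Scope ring_scope.
Local Open Scope complex_scope.
Local Open Scope quotient_scope.

Section MatrixLemmas.
Variable F : fieldType.

Lemma tensmxDl m n k l (A B : 'M[F]_(m, n)) (D : 'M[F]_(k, l)) :
  (A + B) *t D = A *t D + B *t D.
Proof. by apply/matrixP => i j; rewrite !mxE mulrDl. Qed.

Lemma tensmxDr m n k l (D : 'M[F]_(m, n)) (A B : 'M[F]_(k, l)) :
  D *t (A + B) = D *t A + D *t B.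
Proof. by apply/matrixP => i j; rewrite !mxE mulrDr. Qed.

Lemma tensmxZl m n k l c (A : 'M[F]_(m, n)) (B : 'M[F]_(k, l)) :
  (c *: A) *t B = c *: (A *t B).
Proof. by apply/matrixP => i j; rewrite !mxE mulrA. Qed.

Lemma tensmxZr m n k l c (A : 'M[F]_(m, n)) (B : 'M[F]_(k, l)) :
  A *t (c *: B) = c *: (A *t B).
Proof. by apply/matrixP => i j; rewrite !mxE mulrCA. Qed.

Lemma tensmxNl m n k l (A : 'M[F]_(m, n)) (B : 'M[F]_(k, l)) :
  (- A) *t B = - (A *t B).
Proof. by rewrite -scaleN1r tensmxZl scaleN1r. Qed.

Lemma tensmxNr m n k l (A : 'M[F]_(m, n)) (B : 'M[F]_(k, l)) :
  A *t (- B) = - (A *t B).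
Proof. by rewrite -scaleN1r tensmxZr scaleN1r. Qed.

Lemma tensmx11 m n : (1%:M : 'M[F]_m) *t (1%:M : 'M[F]_n) = 1%:M.
Proof.
apply/matrixP => k l; rewrite !mxE -natrM mulnb; congr (_ %:R); congr nat_of_bool.
rewrite -[k]mxtens_unindexK -[l]mxtens_unindexK !mxtens_indexK.
rewrite (inj_eq (can_inj (@mxtens_indexK _ _))).
by case: (mxtens_unindex k) (mxtens_unindex l) => [? ?] [? ?].
Qed.

Lemma tensmxX m n (A : 'M[F]_m) (B : 'M[F]_n) k :
  (A *t B) ^+ k = (A ^+ k) *t (B ^+ k).
Proof.
elim: k => [|k IH]; first by rewrite !expr0 tensmx11.
by rewrite !exprS IH -!mulmxE tensmx_mul.
Qed.

Lemma tensmxA_proof m n k (l : 'I_(m * (n * k))) (j : 'I_(m * n * k)) :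
  j = l :> nat ->
  [/\ (mxtens_unindex l).1 = (mxtens_unindex (mxtens_unindex j).1).1,
      (mxtens_unindex (mxtens_unindex l).2).1
        = (mxtens_unindex (mxtens_unindex j).1).2
    & (mxtens_unindex (mxtens_unindex l).2).2 = (mxtens_unindex j).2].
Proof.
case: (mxtens_indexP l) => a b; case: (mxtens_indexP b) => b1 b2 jE.
have -> : j = mxtens_index (mxtens_index (a, b1), b2).
  by apply: val_inj; rewrite /= jE /= mulnDl mulnA addnA.
by rewrite !mxtens_indexK.
Qed.

Lemma tensmxA m n k m' n' k' (A : 'M[F]_(m, m')) (B : 'M[F]_(n, n'))
    (D : 'M[F]_(k, k')) :
  castmx (esym (mulnA _ _ _), esym (mulnA _ _ _)) (A *t B *t D)
  = A *t (B *t D).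
Proof.
apply/matrixP => i j; rewrite castmxE !mxE !esymK.
have [-> -> ->] := @tensmxA_proof _ _ _ i (cast_ord (mulnA _ _ _) i) erefl.
have [-> -> ->] := @tensmxA_proof _ _ _ j (cast_ord (mulnA _ _ _) j) erefl.
by rewrite mulrA.
Qed.

Lemma castmxD m n m' n' (e : (m = m') * (n = n')) (A B : 'M[F]_(m, n)) :
  castmx e (A + B) = castmx e A + castmx e B.
Proof. by case: e => e1 e2; case: _ / e1; case: _ / e2; rewrite !castmx_id. Qed.

Lemma invmx_uniq n (A B : 'M[F]_n) : A *m B = 1%:M -> invmx A = B.
Proof.
move=> AB; have [uA _] := mulmx1_unit AB.
by rewrite -[LHS]mulmx1 -AB mulmxA mulVmx // mul1mx.
Qed.

Fixpoint gauss (z : F) (n k : nat) : F :=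
  match n, k with
  | _, 0 => 1
  | 0, _.+1 => 0
  | n'.+1, k'.+1 => z ^+ (n' - k') * gauss z n' k' + gauss z n' k
  end.

Lemma gauss0 z n : gauss z n 0 = 1. Proof. by case: n. Qed.

Lemma gauss_small z n k : (n < k)%N -> gauss z n k = 0.
Proof.
elim: n k => [|n IH] [|k] //= nk.
by rewrite !IH ?mulr0 ?addr0 // ltnW.
Qed.

Lemma gauss_prod z n k :
  gauss z n k * \prod_(j < k) (1 - z ^+ j.+1) = \prod_(j < k) (1 - z ^+ (n - j)).
Proof.
elim: n k => [|n IH] [|k]; rewrite ?gauss0 ?big_ord0 ?mulr1 //.
  by rewrite mul0r big_ord_recl subnn expr0 subrr mul0r.
have := IH k.+1; rewrite /= mulrDl => ->.
rewrite [X in X + _](_ : _ =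
  z ^+ (n - k) * (1 - z ^+ k.+1) * \prod_(j < k) (1 - z ^+ (n - j))); last first.
  by rewrite -IH big_ord_recr /=; ring.
rewrite [in RHS]big_ord_recl big_ord_recr /= subn0.
rewrite [in RHS](eq_bigr (fun j : 'I_k => 1 - z ^+ (n - j))) //.
have [kn|nk] := leqP k n.
  have -> : z ^+ n.+1 = z ^+ (n - k) * z ^+ k.+1.
    by rewrite -exprD addnS subnK.
  by ring.
suff -> : \prod_(j < k) (1 - z ^+ (n - j)) = 0 by rewrite !mulr0 mul0r addr0.
by rewrite (bigD1 (Ordinal nk)) //= subnn expr0 subrr mul0r.
Qed.

Lemma exprD_gauss z n (X Y : 'M[F]_n) k : Y *m X = z *: (X *m Y) ->
  (X + Y) ^+ k = \sum_(i < k.+1) gauss z k i *: (X ^+ i *m Y ^+ (k - i)).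
Proof.
move=> YX; have YXk m : Y ^+ m *m X = z ^+ m *: (X *m Y ^+ m).
  elim: m => [|m IH]; first by rewrite !expr0 scale1r mulmx1 mul1mx.
  rewrite [in LHS]exprSr -mulmxE -mulmxA YX -scalemxAr.
  by rewrite [in LHS]mulmxA IH -scalemxAl scalerA -exprS -mulmxA [Y ^+ m.+1]exprSr.
elim: k => [|k IH].
  by rewrite big_ord_recl big_ord0 !expr0 addr0 scale1r mulmx1.
rewrite exprSr IH -mulmxE mulmxDr.
rewrite [in RHS]big_ord_recl gauss0 scale1r expr0 mul1mx subn0.
rewrite [in RHS](eq_bigr (fun i : 'I_k.+1 =>
   gauss z k i *: (X ^+ i *m Y ^+ (k - i)) *m X +
   gauss z k i.+1 *: (X ^+ i.+1 *m Y ^+ (k - i)))); last first.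
  move=> i _; rewrite lift0 subSS [gauss _ _ _]/= scalerDl; congr (_ + _).
  rewrite -scalemxAl -mulmxA YXk -scalemxAr scalerA mulrC; congr (_ *: _).
  by rewrite mulmxA exprSr.
rewrite big_split /= mulmx_suml addrCA; congr (_ + _).
transitivity (\sum_(i < k.+2) gauss z k i *: (X ^+ i *m Y ^+ (k.+1 - i))).
  rewrite [in RHS]big_ord_recr /= (gauss_small _ (ltnSn k)) scale0r addr0.
  rewrite mulmx_suml.
  apply: eq_bigr => i _; rewrite -scalemxAl -mulmxA mulmxE -exprSr.
  by rewrite subSn // -ltnS.
by rewrite big_ord_recl gauss0 scale1r expr0 mul1mx subn0.
Qed.

Lemma exprD_eq0 z n (X Y : 'M[F]_n) k : (0 < k)%N ->
  Y *m X = z *: (X *m Y) -> z ^+ k = 1 ->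
  (forall j, (0 < j < k)%N -> z ^+ j != 1) ->
  X ^+ k = 0 -> Y ^+ k = 0 -> (X + Y) ^+ k = 0.
Proof.
move=> k0 YX zk zj Xk Yk; rewrite (exprD_gauss k YX) big1 // => i _.
have [i0|i0] := posnP i; first by rewrite i0 subn0 Yk mulmx0 scaler0.
have := ltn_ord i; rewrite ltnS leq_eqVlt => /orP[/eqP->|ik].
  by rewrite Xk mul0mx scaler0.
suff -> : gauss z k i = 0 by rewrite scale0r.
have := gauss_prod z k i; case: (nat_of_ord i) i0 ik => // m _ mk.
rewrite [in RHS]big_ord_recl subn0 zk subrr mul0r => /eqP.
rewrite mulf_eq0 => /orP[/eqP //|/prodf_eq0[j _]].
by rewrite subr_eq0 eq_sym (negbTE (zj _ _)) //= (leq_ltn_trans _ mk).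
Qed.

End MatrixLemmas.

Section RestrictedQuantumGroup.
Variables (R : realType) (p : nat).
Local Notation C := R[i].

Definition q : C := cos (pi / p%:R) +i* sin (pi / p%:R).

Definition qint (n : nat) : C := (q ^+ n - q ^- n) / (q - q^-1).

Lemma cis_expn (x : R) n :
  (cos x +i* sin x) ^+ n = cos (n%:R * x) +i* sin (n%:R * x).
Proof.
elim: n => [|n IH]; first by rewrite expr0 mul0r cos0 sin0.
rewrite exprSr IH -natr1 mulrDl mul1r cosD sinD.
by apply/eqP; rewrite eq_complex /= eqxx /= addrC.
Qed.

Lemma cis_neq0 (x : R) : cos x +i* sin x != 0.
Proof.
apply/negP => /eqP [c0 s0]; have := cos2Dsin2 x.
rewrite c0 s0 expr0n addr0 => /esym/eqP.
by rewrite oner_eq0.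
Qed.

Lemma q_neq0 : q != 0. Proof. exact: cis_neq0. Qed.

Lemma q_pow2p : q ^+ (2 * p) = 1.
Proof.
case: (posnP p) => [->|p0]; first by rewrite muln0 expr0.
rewrite cis_expn natrM -mulrA [p%:R * _]mulrC divfK; last first.
  by rewrite pnatr_eq0 -lt0n.
by rewrite mulr_natl cos2pi sin2pi.
Qed.

Lemma q2_expn_neq1 j : (0 < j < p)%N -> (q ^+ 2) ^+ j != 1.
Proof.
case/andP=> j0 jp; have p0 : 0 < p%:R :> R by rewrite ltr0n (ltn_trans j0).
rewrite -exprM mulnC exprM cis_expn; move xE : (j%:R * _) => x.
have sj : 0 < sin x.
  apply: sin_gt0_pi; rewrite -xE mulrCA; apply/andP; split.
    by rewrite mulr_gt0 ?pi_gt0 // divr_gt0 // ltr0n.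
  by rewrite gtr_pMr ?pi_gt0 // ltr_pdivrMr // mul1r ltr_nat.
apply/eqP; rewrite expr2 => -[e _].
have := cos2Dsin2 x; move: e.
set c := cos x; set s := sin x => e e'.
have: 2 * s ^+ 2 = 0.
  have -> : 2 * s ^+ 2 = (c ^+ 2 + s ^+ 2) - (c * c - s * s) by ring.
  by rewrite e e' subrr.
by apply/eqP; rewrite mulf_neq0 ?pnatr_eq0 // expf_neq0 // gt_eqF.
Qed.

(* The defining relations; K is invertible because K ^+ (2 * p) = 1. *)
Definition is_rep n (E F K : 'M[C]_n) : Prop :=
  [/\ [/\ E ^+ p = 0, F ^+ p = 0 & K ^+ (2 * p) = 1],
      K *m E *m invmx K = q ^+ 2 *: E,
      K *m F *m invmx K = q ^- 2 *: F &
      E *m F - F *m E = (q - q^-1)^-1 *: (K - invmx K)].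

(* Since the restricted quantum group is given by generators and relations, a
   module structure on the space of column vectors of size dim is a triple of
   matrices satisfying the relations; up to isomorphism these are all the
   finite-dimensional modules. *)
Record Umod := MkUmod {
  dim : nat;
  Eop : 'M[C]_dim;
  Fop : 'M[C]_dim;
  Kop : 'M[C]_dim;
  Umod_rep : is_rep Eop Fop Kop
}.

HB.instance Definition _ := gen_eqMixin Umod.
HB.instance Definition _ := gen_choiceMixin Umod.

Lemma Umod_eq (M N : Umod) (e : dim M = dim N) :
  castmx (e, e) (Eop M) = Eop N -> castmx (e, e) (Fop M) = Fop N ->
  castmx (e, e) (Kop M) = Kop N -> M = N.
Proof.
case: M N e => m E F K h [n E' F' K' h'] /= e.
case: n / e E' F' K' h' => E' F' K' h'; rewrite !castmx_id => e1 e2 e3.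
by case: _ / e1 h'; case: _ / e2; case: _ / e3 => h'; rewrite (Prop_irrelevance h h').
Qed.

Definition Uhom (M N : Umod) (f : 'M[C]_(dim N, dim M)) : Prop :=
  [/\ f *m Eop M = Eop N *m f, f *m Fop M = Fop N *m f
    & f *m Kop M = Kop N *m f].

Definition Uiso (M N : Umod) : Prop :=
  exists (f : 'M[C]_(dim N, dim M)) (g : 'M[C]_(dim M, dim N)),
    [/\ Uhom f, g *m f = 1%:M & f *m g = 1%:M].

Definition submodule (M : Umod) (W : {vspace 'cV[C]_(dim M)}) : Prop :=
  forall v, v \in W ->
    [/\ Eop M *m v \in W, Fop M *m v \in W & Kop M *m v \in W].

Definition irreducible (M : Umod) : Prop :=
  (0 < dim M)%N /\
  forall W : {vspace 'cV[C]_(dim M)}, submodule W -> W = 0%VS \/ W = fullv.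

Definition short_exact (M' M M'' : Umod)
    (f : 'M[C]_(dim M, dim M')) (g : 'M[C]_(dim M'', dim M)) : Prop :=
  [/\ Uhom f, Uhom g,
      forall u : 'cV_(dim M'), f *m u = 0 -> u = 0,
      forall w : 'cV_(dim M''), exists v, g *m v = w
    & forall v : 'cV_(dim M), g *m v = 0 <-> exists u, f *m u = v].

Lemma short_exact_split M' M M'' (f : 'M[C]_(dim M, dim M'))
    (g : 'M[C]_(dim M'', dim M)) :
  short_exact f g <-> [/\ Uhom f, Uhom g & exists h k,
    [/\ h *m f = 1%:M, g *m k = 1%:M, g *m f = 0 & f *m h + k *m g = 1%:M]].
Proof.
split=> [[hf hg inj surj ex]|[hf hg [h [k [hfE gkE gfE fhkg]]]]]; split=> //.
- have gf0 : g *m f = 0.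
    apply/matrixP => i j.
    have : g *m (f *m delta_mx j 0) = 0 :> 'cV_(dim M'').
      by apply/ex; exists (delta_mx j 0).
    by rewrite mulmxA -colE => /matrixP/(_ i 0); rewrite [LHS]mxE => ->; rewrite !mxE.
  have [k kE] := fin_all_exists (fun j : 'I_(dim M'') => surj (delta_mx j 0)).
  pose k' : 'M_(dim M, dim M'') := \matrix_(i, j) k j i 0.
  have k'E : g *m k' = 1%:M.
    apply/matrixP => i j; have /matrixP/(_ i 0) := kE j.
    by rewrite !mxE eqxx andbT => <-; apply: eq_bigr => l _; rewrite mxE.
  have H j : exists u, f *m u = col j (1%:M - k' *m g).
    apply/ex; rewrite colE mulmxA mulmxBr mulmx1 mulmxA k'E mul1mx subrr.
    by rewrite mul0mx.
  have [h hE] := fin_all_exists H.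
  pose h' : 'M_(dim M', dim M) := \matrix_(i, j) h j i 0.
  have h'E : f *m h' = 1%:M - k' *m g.
    apply/matrixP => i j; have /matrixP/(_ i 0) := hE j.
    rewrite [RHS]mxE => <-; rewrite !mxE.
    by apply: eq_bigr => l _; rewrite mxE.
  exists h', k'; split=> //; last by rewrite h'E subrK.
  apply/matrixP => i j.
  have : (h' *m f - 1%:M) *m delta_mx j (0 : 'I_1) = 0.
    apply: inj; rewrite mulmxA mulmxBr mulmx1 [f *m (h' *m f)]mulmxA h'E.
    by rewrite [_ *m f]mulmxBl mul1mx -mulmxA gf0 mulmx0 subr0 subrr mul0mx.
  rewrite -colE => /matrixP/(_ i 0); rewrite mxE [RHS]mxE.
  by rewrite [LHS]mxE [X in _ + X]mxE => /eqP; rewrite subr_eq0 => /eqP.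
- by move=> u fu; rewrite -[u]mul1mx -hfE -mulmxA fu mulmx0.
- by move=> w; exists (k *m w); rewrite mulmxA gkE mul1mx.
- move=> v; split=> [gv|[u <-]]; last by rewrite mulmxA gfE mul0mx.
  exists (h *m v); rewrite mulmxA -[RHS]mul1mx -fhkg mulmxDl -[k *m g *m v]mulmxA gv.
  by rewrite mulmx0 addr0.
Qed.

Section Tensor.
Hypothesis hp : (1 < p)%N.

Let p_gt0 : (0 < p)%N. Proof. exact: ltnW. Qed.

Lemma Kop_unit n (E F K : 'M[C]_n) : is_rep E F K -> K \in unitmx.
Proof.
case=> -[_ _ K2p] _ _ _.
have : K *m K ^+ (2 * p).-1 = 1%:M by rewrite mulmxE -exprS prednK ?muln_gt0.
by case/mulmx1_unit.
Qed.

Lemma triv_is_rep : is_rep (0 : 'M[C]_1) 0 1%:M.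
Proof.
split; rewrite ?mulmx0 ?mul0mx ?scaler0 //.
  by split; rewrite ?expr0n ?eqn0Ngt ?p_gt0 // expr1n.
by rewrite invmx1 !subrr scaler0.
Qed.

(* E, F and K act through the counit. *)
Definition triv : Umod := MkUmod triv_is_rep.

Lemma rep_comm n (E F K : 'M[C]_n) : is_rep E F K ->
  [/\ K *m E = q ^+ 2 *: (E *m K), E *m invmx K = q ^+ 2 *: (invmx K *m E),
      F *m K = q ^+ 2 *: (K *m F) & invmx K *m F = q ^+ 2 *: (F *m invmx K)].
Proof.
move=> rep; have uK := Kop_unit rep; case: rep => _ KE KF _.
have q20 : q ^+ 2 != 0 by rewrite expf_neq0 ?q_neq0.
have {}KE : K *m E = q ^+ 2 *: (E *m K).
  by rewrite scalemxAl -KE mulmxKV.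
have {}KF : F *m K = q ^+ 2 *: (K *m F).
  have : K *m F = q ^- 2 *: (F *m K) by rewrite scalemxAl -KF mulmxKV.
  by move=> ->; rewrite scalerA divff // scale1r.
split=> //.
  rewrite -[E in LHS](mulKmx uK) KE -!scalemxAr -scalemxAl.
  by rewrite mulmxA mulmxK.
rewrite -[F in LHS](mulmxK uK) KF -scalemxAl -!scalemxAr.
by rewrite mulmxA mulKmx.
Qed.

Lemma tens_is_rep m n (E F K : 'M[C]_m) (E' F' K' : 'M[C]_n) :
  is_rep E F K -> is_rep E' F' K' ->
  is_rep (1%:M *t E' + E *t K') (invmx K *t F' + F *t 1%:M) (K *t K').
Proof.
move=> rep rep'; have uK := Kop_unit rep; have uK' := Kop_unit rep'.
have [KE EV FK VF] := rep_comm rep; have [KE' EV' FK' VF'] := rep_comm rep'.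
case: rep rep' => -[Ep Fp Kp] cE cF EF [[Ep' Fp' Kp'] cE' cF' EF'].
have Vt : invmx (K *t K') = invmx K *t invmx K'.
  by apply: invmx_uniq; rewrite tensmx_mul !mulmxV // tensmx11.
have z1 : (q ^+ 2) ^+ p = 1 by rewrite -exprM q_pow2p.
have zj j : (0 < j < p)%N -> (q ^+ 2) ^+ j != 1 := @q2_expn_neq1 j.
split.
- split; last by rewrite tensmxX Kp Kp' tensmx11.
  + apply: (exprD_eq0 p_gt0 _ z1 zj).
    * by rewrite !tensmx_mul mul1mx mulmx1 KE' tensmxZr.
    * by rewrite tensmxX Ep' tensmx0.
    * by rewrite tensmxX Ep tens0mx.
  + rewrite addrC; apply: (exprD_eq0 p_gt0 _ z1 zj).
    * by rewrite !tensmx_mul mul1mx mulmx1 VF tensmxZl.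
    * by rewrite tensmxX Fp tens0mx.
    * by rewrite tensmxX Fp' tensmx0.
- rewrite Vt mulmxDr mulmxDl !tensmx_mul !mulmx1 !mulmxV // cE cE' mulmxK //.
  by rewrite tensmxZr tensmxZl scalerDr.
- rewrite Vt mulmxDr mulmxDl !tensmx_mul !mulmx1 !mulmxV // cF cF' mul1mx.
  by rewrite tensmxZr tensmxZl scalerDr.
rewrite Vt !mulmxDl !mulmxDr !tensmx_mul !mulmx1 !mul1mx.
rewrite EV FK' tensmxZl tensmxZr.
set c := (q - q^-1)^-1 in EF EF' *.
have -> : c *: (K *t K' - invmx K *t invmx K') =
   invmx K *t (c *: (K' - invmx K')) + (c *: (K - invmx K)) *t K'.
  rewrite tensmxZl tensmxZr -scalerDr; congr (_ *: _).
  by rewrite tensmxDr tensmxDl tensmxNr tensmxNl [RHS]addrC addrA addrNK.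
rewrite -EF -EF' !(tensmxDl, tensmxDr, tensmxNl, tensmxNr).
set a := invmx K *t (E' *m F'); set b := F *t E'; set d := _ *: _.
set e := (E *m F) *t K'; set f := invmx K *t (F' *m E').
set g := (F *m E) *t K'.
apply/matrixP => i j; rewrite !mxE; ring.
Qed.

(* The generators act through the comultiplication:
   Delta E = 1 (x) E + E (x) K, Delta F = K^-1 (x) F + F (x) 1,
   Delta K = K (x) K. *)
Definition tens (M N : Umod) : Umod :=
  MkUmod (tens_is_rep (Umod_rep M) (Umod_rep N)).

Lemma invmx_tens m n (K : 'M[C]_m) (K' : 'M[C]_n) :
  K \in unitmx -> K' \in unitmx -> invmx (K *t K') = invmx K *t invmx K'.
Proof.
by move=> uK uK'; apply: invmx_uniq; rewrite tensmx_mul !mulmxV // tensmx11.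
Qed.

Lemma tens_assoc M N P : tens (tens M N) P = tens M (tens N P).
Proof.
apply: (@Umod_eq (tens (tens M N) P) (tens M (tens N P))
  (esym (mulnA (dim M) (dim N) (dim P)))) => /=.
- by rewrite -tensmx11 tensmxDl tensmxDr !castmxD !tensmxA addrA.
- rewrite invmx_tens ?(Kop_unit (Umod_rep _)) // tensmxDl tensmxDr !castmxD.
  by rewrite !tensmxA addrA tensmx11.
- by rewrite tensmxA.
Qed.

Lemma tens_trivl M : tens triv M = M.
Proof.
apply: (@Umod_eq (tens triv M) M (mul1n (dim M))) => /=;
  by rewrite ?invmx1 ?tens0mx ?addr0 tens_scalar_mx scale1r castmxKV.
Qed.

Lemma tens_trivr M : tens M triv = M.
Proof.
apply: (@Umod_eq (tens M triv) M (muln1 (dim M))) => /=;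
  by rewrite ?tensmx0 ?add0r tens_mx_scalar scale1r castmxKV.
Qed.

Lemma short_exact_tensl M' M M'' N (f : 'M[C]_(dim M, dim M'))
    (g : 'M[C]_(dim M'', dim M)) : short_exact f g ->
  @short_exact (tens M' N) (tens M N) (tens M'' N) (f *t 1%:M) (g *t 1%:M).
Proof.
have homV M1 M2 (u : 'M[C]_(dim M2, dim M1)) :
    Uhom u -> u *m invmx (Kop M1) = invmx (Kop M2) *m u.
  have [u1 u2] := (Kop_unit (Umod_rep M1), Kop_unit (Umod_rep M2)).
  case=> _ _ uK; apply: (can_inj (mulKmx u2)).
  by rewrite mulKVmx // mulmxA -uK mulmxK.
have hom M1 M2 (u : 'M[C]_(dim M2, dim M1)) : Uhom u ->
    @Uhom (tens M1 N) (tens M2 N) (u *t 1%:M).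
  move=> hu; have uV := homV _ _ _ hu; case: hu => uE uF uK.
  split=> /=.
  - by rewrite mulmxDl mulmxDr !tensmx_mul !mulmx1 !mul1mx uE.
  - by rewrite mulmxDl mulmxDr !tensmx_mul !mulmx1 !mul1mx uV uF.
  - by rewrite !tensmx_mul mulmx1 mul1mx uK.
case/short_exact_split => hf hg [h [k [hfE gkE gfE fhkg]]].
apply/short_exact_split; split; rewrite /=; [exact: hom|exact: hom|].
exists (h *t 1%:M), (k *t 1%:M); split; rewrite !tensmx_mul !mulmx1.
- by rewrite hfE tensmx11.
- by rewrite gkE tensmx11.
- by rewrite gfE tens0mx.
- by rewrite -tensmxDl fhkg tensmx11.
Qed.

Lemma short_exact_tensr M' M M'' N (f : 'M[C]_(dim M, dim M'))
    (g : 'M[C]_(dim M'', dim M)) : short_exact f g ->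
  @short_exact (tens N M') (tens N M) (tens N M'') (1%:M *t f) (1%:M *t g).
Proof.
have hom M1 M2 (u : 'M[C]_(dim M2, dim M1)) : Uhom u ->
    @Uhom (tens N M1) (tens N M2) (1%:M *t u).
  case=> uE uF uK.
  split=> /=.
  - by rewrite mulmxDl mulmxDr !tensmx_mul !mulmx1 !mul1mx uE uK.
  - by rewrite mulmxDl mulmxDr !tensmx_mul !mulmx1 !mul1mx uF.
  - by rewrite !tensmx_mul mulmx1 mul1mx uK.
case/short_exact_split => hf hg [h [k [hfE gkE gfE fhkg]]].
apply/short_exact_split; split; rewrite /=; [exact: hom|exact: hom|].
exists (1%:M *t h), (1%:M *t k); split; rewrite !tensmx_mul !mulmx1.
- by rewrite hfE tensmx11.
- by rewrite gkE tensmx11.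
- by rewrite gfE tensmx0.
- by rewrite -tensmxDr fhkg tensmx11.
Qed.

End Tensor.

Section GrothendieckRing.
Hypothesis hp : (1 < p)%N.

Local Notation FG := {freeg Umod / int}.

(* The biadditive extension of the tensor product of modules. *)
Definition FGmul (x y : FG) : FG :=
  fglift (fun M => fglift (fun N => << tens hp M N >>) y) x.

Lemma FGmul_gen M N : FGmul << M >> << N >> = << tens hp M N >>.
Proof. by rewrite /FGmul !liftU !scale1r. Qed.

Lemma FGmulBl : left_distributive FGmul (fun x y => x - y).
Proof. by move=> x y z; rewrite /FGmul lift_is_additive. Qed.

Lemma FG_ind (P : FG -> Prop) : P 0 -> (forall x y, P x -> P y -> P (x - y)) ->
  (forall M, P << M >>) -> forall x, P x.
Proof.
move=> P0 PB PU.
have PN x : P x -> P (- x) by rewrite -sub0r; apply: (PB).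
have PD x y : P x -> P y -> P (x + y).
  by move=> Px Py; rewrite -[y]opprK; apply/PB/PN.
move=> x; rewrite -(freeg_sumE x); elim/big_rec: _ => // M y _ Py.
apply: (PD) => //; move: (coeff M x) => z.
have -> : << z *g M >> = << M >> *~ z.
  by rewrite freegU_mulz intz.
elim/int_ind: z => [|n IH|n IH] //.
- by rewrite intS mulrzDr; apply: (PD) => //; exact: PU.
- by rewrite intS opprD addrC mulrzBr; apply: (PB) => //; exact: PU.
Qed.

Lemma FGmulBr : right_distributive FGmul (fun x y => x - y).
Proof.
have mul0 z : FGmul 0 z = 0 by rewrite -[X in FGmul X _](subrr 0) FGmulBl subrr.
move=> x y z; elim/FG_ind: x => [|x x' IH IH'|M].
- by rewrite !mul0 subr0.
- by rewrite !FGmulBl IH IH' !opprD !opprK addrACA.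
- by rewrite /FGmul !liftU !scale1r lift_is_additive.
Qed.

Lemma FGmul0l x : FGmul 0 x = 0.
Proof. by rewrite -[X in FGmul X _](subrr 0) FGmulBl subrr. Qed.

Lemma FGmul0r x : FGmul x 0 = 0.
Proof. by rewrite -[X in FGmul _ X](subrr 0) FGmulBr subrr. Qed.

Lemma FGmulA : associative FGmul.
Proof.
move=> x y z; elim/FG_ind: x => [|x x' IH IH'|M].
- by rewrite !FGmul0l.
- by rewrite !FGmulBl IH IH'.
elim/FG_ind: y => [|y y' IH IH'|N].
- by rewrite FGmul0l !FGmul0r FGmul0l.
- by rewrite FGmulBl !FGmulBr FGmulBl IH IH'.
elim/FG_ind: z => [|z z' IH IH'|P].
- by rewrite !FGmul0r.
- by rewrite !FGmulBr IH IH'.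
by rewrite !FGmul_gen tens_assoc.
Qed.

Lemma FGmul1l : left_id << triv hp >> FGmul.
Proof.
move=> x; elim/FG_ind: x => [|x x' IH IH'|M].
- exact: FGmul0r.
- by rewrite FGmulBr IH IH'.
- by rewrite FGmul_gen tens_trivl.
Qed.

Lemma FGmul1r : right_id << triv hp >> FGmul.
Proof.
move=> x; elim/FG_ind: x => [|x x' IH IH'|M].
- exact: FGmul0l.
- by rewrite FGmulBl IH IH'.
- by rewrite FGmul_gen tens_trivr.
Qed.

(* The subgroup of the free abelian group on all modules generated by the
   [M] - [M'] - [M''] for the short exact sequences 0 -> M' -> M -> M'' -> 0. *)
Inductive ses_span : FG -> Prop :=
| ses_span0 : ses_span 0
| ses_spanB x y : ses_span x -> ses_span y -> ses_span (x - y)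
| ses_span_ses (M' M M'' : Umod) (f : 'M[C]_(dim M, dim M'))
    (g : 'M[C]_(dim M'', dim M)) :
    short_exact f g -> ses_span (<< M >> - << M' >> - << M'' >>).

Definition ses_pred : {pred FG} := fun x => `[< ses_span x >].

Lemma ses_pred_zmod_closed : zmod_closed ses_pred.
Proof.
split; first by apply/asboolP; exact: ses_span0.
by move=> x y /asboolP sx /asboolP sy; apply/asboolP; exact: ses_spanB.
Qed.

HB.instance Definition _ :=
  GRing.isZmodClosed.Build FG ses_pred ses_pred_zmod_closed.

Lemma ses_span_mull x y : ses_span x -> ses_span (FGmul x y).
Proof.
move=> sx; elim/FG_ind: y => [|y y' IH IH'|N].
- by rewrite FGmul0r; exact: ses_span0.
- by rewrite FGmulBr; exact: ses_spanB.
elim: sx => [|{}x x' _ IH _ IH'|M' M M'' f g fg].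
- by rewrite FGmul0l; exact: ses_span0.
- by rewrite FGmulBl; exact: ses_spanB.
- by rewrite !FGmulBl !FGmul_gen; apply/ses_span_ses/(short_exact_tensl hp N fg).
Qed.

Lemma ses_span_mulr x y : ses_span x -> ses_span (FGmul y x).
Proof.
move=> sx; elim/FG_ind: y => [|y y' IH IH'|N].
- by rewrite FGmul0l; exact: ses_span0.
- by rewrite FGmulBl; exact: ses_spanB.
elim: sx => [|{}x x' _ IH _ IH'|M' M M'' f g fg].
- by rewrite FGmul0r; exact: ses_span0.
- by rewrite FGmulBr; exact: ses_spanB.
- by rewrite !FGmulBr !FGmul_gen; apply/ses_span_ses/(short_exact_tensr hp N fg).
Qed.

Lemma FGmul_pi (x x' y y' : FG) :
  x = x' %[mod {ideal_quot ses_pred}] -> y = y' %[mod {ideal_quot ses_pred}] ->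
  FGmul x y = FGmul x' y' %[mod {ideal_quot ses_pred}].
Proof.
move=> /eqP; rewrite -Quotient.idealrBE => /asboolP xx'.
move=> /eqP; rewrite -Quotient.idealrBE => /asboolP yy'.
apply/eqP; rewrite -Quotient.idealrBE; apply/asboolP.
have -> : FGmul x y - FGmul x' y' = FGmul (x - x') y - FGmul x' (y' - y).
  by rewrite FGmulBl FGmulBr opprB addrA addrNK.
apply: ses_spanB; first exact: ses_span_mull.
by apply: ses_span_mulr; rewrite -opprB -sub0r; apply/ses_spanB/yy'/ses_span0.
Qed.

End GrothendieckRing.

(* The hypothesis 1 < p is an argument of the type because the tensor product,
   hence the ring structure below, needs p to be positive. *)
Definition K0 (_ : (1 < p)%N) : Type := {ideal_quot ses_pred}.

HB.instance Definition _ hp := GRing.Zmodule.on (K0 hp).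

Section K0Ring.
Hypothesis hp : (1 < p)%N.

Definition K0class (M : Umod) : K0 hp := \pi_{ideal_quot ses_pred} << M >>.

Definition K0one : K0 hp := K0class (triv hp).

Definition K0mul (x y : K0 hp) : K0 hp :=
  \pi_{ideal_quot ses_pred}
    (FGmul hp (repr (x : {ideal_quot ses_pred})) (repr (y : {ideal_quot ses_pred}))).

Lemma pi_K0mul x y :
  \pi_{ideal_quot ses_pred} (FGmul hp x y)
  = K0mul (\pi_{ideal_quot ses_pred} x) (\pi_{ideal_quot ses_pred} y).
Proof. by apply: FGmul_pi; rewrite reprK. Qed.

Lemma K0_ind (P : K0 hp -> Prop) :
  (forall x : {freeg Umod / int}, P (\pi_{ideal_quot ses_pred} x)) -> forall x, P x.
Proof. by move=> Ppi x; rewrite -[x](@reprK _ {ideal_quot ses_pred}). Qed.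

Lemma pi_K0B (x y : {freeg Umod / int}) :
  \pi_{ideal_quot ses_pred} x - \pi_{ideal_quot ses_pred} y
  = \pi_{ideal_quot ses_pred} (x - y) :> K0 hp.
Proof. by rewrite -[LHS]/(_ - _ : {ideal_quot ses_pred}) !piE. Qed.

Lemma pi_K0D (x y : {freeg Umod / int}) :
  \pi_{ideal_quot ses_pred} x + \pi_{ideal_quot ses_pred} y
  = \pi_{ideal_quot ses_pred} (x + y) :> K0 hp.
Proof. by rewrite -[LHS]/(_ + _ : {ideal_quot ses_pred}) !piE. Qed.

Lemma K0mulA : associative K0mul.
Proof.
elim/K0_ind => x; elim/K0_ind => y; elim/K0_ind => z.
by rewrite -!pi_K0mul FGmulA.
Qed.

Lemma K0mul1l : left_id K0one K0mul.
Proof. by elim/K0_ind => x; rewrite -pi_K0mul FGmul1l. Qed.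

Lemma K0mul1r : right_id K0one K0mul.
Proof. by elim/K0_ind => x; rewrite -pi_K0mul FGmul1r. Qed.

Lemma FGmulDl : left_distributive (FGmul hp) +%R.
Proof.
move=> x y z; rewrite -[y in LHS]opprK FGmulBl -[- y]sub0r FGmulBl FGmul0l.
by rewrite sub0r opprK.
Qed.

Lemma FGmulDr : right_distributive (FGmul hp) +%R.
Proof.
move=> x y z; rewrite -[z in LHS]opprK FGmulBr -[- z]sub0r FGmulBr FGmul0r.
by rewrite sub0r opprK.
Qed.

Lemma K0mulDl : left_distributive K0mul +%R.
Proof.
elim/K0_ind => x; elim/K0_ind => y; elim/K0_ind => z.
by rewrite pi_K0D -!pi_K0mul pi_K0D FGmulDl.
Qed.

Lemma K0mulDr : right_distributive K0mul +%R.
Proof.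
elim/K0_ind => x; elim/K0_ind => y; elim/K0_ind => z.
by rewrite pi_K0D -!pi_K0mul pi_K0D FGmulDr.
Qed.

HB.instance Definition _ := GRing.Zmodule_isPzRing.Build (K0 hp)
  K0mulA K0mul1l K0mul1r K0mulDl K0mulDr.

End K0Ring.

(* The sign alpha is encoded by a : bool, as alpha = (-1) ^+ a. *)
Section Irreps.
Variables (a : bool) (s : nat).

Definition X_E : 'M[C]_s :=
  \matrix_(m, n) if n == m.+1 :> nat then (-1) ^+ a * qint n * qint (s - n) else 0.

Definition X_F : 'M[C]_s := \matrix_(m, n) (m == n.+1 :> nat)%:R.

Definition X_K : 'M[C]_s :=
  diag_mx (\row_n ((-1) ^+ a * q ^ (s%:Z - 1 - 2 * n%:Z))).

Lemma nilp_grading (w : 'I_s -> nat) (A : 'M[C]_s) m :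
  (forall k, w k < s)%N -> (forall k n, A k n != 0 -> w n = (w k).+1) ->
  (s <= m)%N -> A ^+ m = 0.
Proof.
move=> ws Aw sm.
have Am l k n : (A ^+ l) k n != 0 -> w n = (w k + l)%N.
  elim: l k n => [|l IH] k n; first by rewrite expr0 mxE; case: (eqVneq k n) => [->|_]; rewrite ?addn0 ?eqxx.
  rewrite exprSr -mulmxE mxE => nz.
  have [j _ jnz] : exists2 j, true & (A ^+ l) k j * A j n != 0.
    apply/exists_inP; apply: contraNT nz; rewrite negb_exists => /forallP h.
    by rewrite big1 // => j _; apply/eqP; move: (h j) => /=; rewrite negbK.
  move: jnz; rewrite mulf_eq0 negb_or => /andP[/IH wj /Aw ->]; rewrite wj.
  by rewrite addnS.
apply/matrixP => k n; rewrite [RHS]mxE; apply/eqP/negPn/negP => /Am wn.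
by have := ws n; rewrite wn ltnNge (leq_trans sm) // leq_addl.
Qed.

Lemma X_EF : X_E *m X_F = diag_mx (\row_n ((-1) ^+ a * qint n.+1 * qint (s - n.+1))).
Proof.
apply/matrixP => k n; rewrite !mxE.
have [ns|sn] := ltnP n.+1 s.
  rewrite (bigD1 (Ordinal ns)) //= !mxE eqxx mulr1 big1 => [|j jn]; last first.
    by rewrite !mxE (_ : (j == n.+1 :> nat) = false) ?mulr0 //; apply: negbTE.
  by rewrite addr0 eqSS eq_sym; case: (eqVneq k n) => [->|kn];
     rewrite ?eqxx ?mulr1n // (_ : (k == n :> nat) = false) ?mulr0n //; apply: negbTE.
rewrite big1 => [|j _]; last first.
  by rewrite !mxE (ltn_eqF (leq_trans (ltn_ord j) sn)) mulr0.
case: (eqVneq k n) => [->|]; last by rewrite mulr0n.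
have -> : (s - n.+1 = 0)%N by apply/eqP; rewrite subn_eq0.
by rewrite /qint !expr0 invr1 subrr mul0r mulr0 mul0rn.
Qed.

Lemma X_FE : X_F *m X_E = diag_mx (\row_n ((-1) ^+ a * qint n * qint (s - n))).
Proof.
apply/matrixP => k n; rewrite !mxE.
case: k => -[|k] ks /=.
  rewrite big1 => [|j _]; last by rewrite !mxE mul0r.
  case: eqP => [_|]; last by rewrite mulr0n.
  by rewrite /qint !expr0 invr1 subrr mul0r mulr0 mul0r mul0rn.
rewrite (bigD1 (Ordinal (ltnW ks))) //= !mxE eqxx mul1r big1 => [|j jn]; last first.
  by rewrite !mxE eqSS (_ : (k == j :> nat) = false) ?mul0r //; rewrite eq_sym; apply: negbTE.
rewrite addr0 /= eq_sym -val_eqE /=.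
by case: eqP => [->|_]; rewrite ?mulr1n ?mulr0n.
Qed.

Lemma sign2 : (-1) ^+ a * (-1) ^+ a = 1 :> C.
Proof. by rewrite -expr2 sqrr_sign. Qed.

Lemma X_KV : invmx X_K = diag_mx (\row_n ((-1) ^+ a * q ^ (- (s%:Z - 1 - 2 * n%:Z)))).
Proof.
apply: invmx_uniq; rewrite mulmx_diag; apply/matrixP => k n; rewrite !mxE.
congr (_ *+ _); rewrite mulrACA sign2 mul1r -expfzDr ?q_neq0 //.
by rewrite subrr.
Qed.

Lemma qint_rec m n :
  qint n.+1 * qint m - qint n * qint m.+1
  = (q - q^-1)^-1 * (q ^ (m%:Z - n%:Z) - q ^ (n%:Z - m%:Z)).
Proof.
have q0 := q_neq0; have qn k : q ^+ k != 0 by rewrite expf_neq0.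
rewrite !expfzDr // -!exprnN -!exprnP /qint !exprS.
have := qn m; have := qn n; move: (q ^+ m) (q ^+ n) => B A A0 B0.
have: (q - q^-1)^-1 * (q - q^-1) * (q - q^-1)^-1 = (q - q^-1)^-1.
  by case: (eqVneq (q - q^-1) 0) => [->|d0]; rewrite ?invr0 ?mulr0 // mulVf ?mul1r.
move: q q0 => z z0; move: (z - z^-1)^-1 => c cE; rewrite -[c in RHS]cE.
by field; rewrite z0 A0 B0.
Qed.

Lemma X_is_rep : (s <= p)%N -> is_rep X_E X_F X_K.
Proof.
move=> sp; split; first split.
- apply: (@nilp_grading (fun k => k)) => // k n; rewrite mxE.
  by case: ifP => [/eqP //|_]; rewrite eqxx.
- apply: (@nilp_grading (fun k => s - k.+1)%N) => // [k|k n].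
    by rewrite ltn_subrL /= (leq_ltn_trans _ (ltn_ord k)).
  rewrite mxE; case: (k =P n.+1 :> nat) => [kn _|_]; last by rewrite eqxx.
  by rewrite -subSn ?kn // -kn ltn_ord.
- have -> m : X_K ^+ m = diag_mx (\row_n ((-1) ^+ a * q ^ (s%:Z - 1 - 2 * n%:Z)) ^+ m).
    elim: m => [|m IH].
      by rewrite expr0; apply/matrixP => k n; rewrite !mxE expr0.
    rewrite exprS IH -mulmxE mulmx_diag; congr diag_mx.
    by apply/rowP => n; rewrite !mxE exprS.
  apply/matrixP => k n; rewrite !mxE exprMn.
  rewrite [X in X * _]exprM sqrr_sign expr1n mul1r.
  by rewrite exprnP exprzAC -exprnP q_pow2p exp1rz.
- rewrite X_KV; apply/matrixP => k n; rewrite mul_diag_mx mul_mx_diag !mxE.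
  case: eqP => [kn|_]; last by rewrite !(mulr0, mul0r).
  have -> : q ^+ 2 = q ^ (s%:Z - 1 - 2 * k%:Z) * q ^ (- (s%:Z - 1 - 2 * n%:Z)).
    by rewrite -expfzDr ?q_neq0 // exprnP; congr (_ ^ _); rewrite kn intS; ring.
  by rewrite mulrAC; congr (_ * _); rewrite mulrACA sign2 mul1r.
- rewrite X_KV; apply/matrixP => k n; rewrite mul_diag_mx mul_mx_diag !mxE.
  case: eqP => [kn|_]; last by rewrite !(mulr0, mul0r).
  have -> : q ^- 2 = q ^ (s%:Z - 1 - 2 * k%:Z) * q ^ (- (s%:Z - 1 - 2 * n%:Z)).
    by rewrite -expfzDr ?q_neq0 // exprnN; congr (_ ^ _); rewrite kn intS; ring.
  by rewrite mulrAC; congr (_ * _); rewrite mulrACA sign2 mul1r.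
rewrite X_EF X_FE X_KV; apply/matrixP => k n; rewrite !mxE.
case: (eqVneq k n) => [->|_]; last by rewrite !mulr0n !subrr mulr0.
rewrite !mulr1n; have := qint_rec (s - n.+1) n.
have -> : (s - n.+1)%N.+1 = (s - n)%N by rewrite subnSK.
have -> : (s - n.+1)%N%:Z - n%:Z = s%:Z - 1 - 2 * n%:Z.
  by rewrite -subzn // intS; ring.
have -> : n%:Z - (s - n.+1)%N%:Z = - (s%:Z - 1 - 2 * n%:Z).
  by rewrite -subzn // intS; ring.
by move=> H; rewrite -!(mulrA ((-1) ^+ a)) -!(mulrBr ((-1) ^+ a)) H mulrCA.
Qed.

End Irreps.

(* X^alpha(s), alpha = (-1) ^+ a; meaningful for 1 <= s <= p only.  For s > p the
   operators above do not satisfy the relations, and Xmod is the zero module. *)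
Definition Xmod (a : bool) (s : nat) : Umod :=
  if @idP (s <= p)%N is ReflectT sp then MkUmod (X_is_rep a sp)
  else MkUmod (X_is_rep a (leq0n p)).

(* Given a family f of elements f a s standing for X^alpha(s) (or chi^alpha(s)),
   the element X~^alpha(s), for 1 <= s <= 2p - 1. *)
Definition tilde (V : zmodType) (f : bool -> nat -> V) (a : bool) (s : nat) : V :=
  if (s <= p)%N then f a s
  else f a (2 * p - s)%N + f (~~ a) (s - p)%N *+ 2.

Definition fusion_rhs (V : zmodType) (f : bool -> nat -> V)
    (a : bool) (s : nat) (a' : bool) (s' : nat) : V :=
  let d := absz (s%:Z - s'%:Z) in
  \sum_(d.+1 <= t < s + s' | ~~ odd (t - d.+1)) tilde f (a (+) a') t.

(* The algebra G_2p: the free abelian group on the elements chi^alpha(s); the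
   coordinate of index (a, j) is the coefficient of chi^alpha(j + 1). *)
Definition fusion : Type := {ffun bool * 'I_p -> int}.

HB.instance Definition _ := GRing.Zmodule.on fusion.

Definition chi (a : bool) (s : nat) : fusion :=
  [ffun x : bool * 'I_p => ((x.1 == a) && (x.2.+1 == s :> nat))%:R].

Definition fusion_mul (x y : fusion) : fusion :=
  \sum_(i : bool * 'I_p) \sum_(j : bool * 'I_p)
    fusion_rhs chi i.1 i.2.+1 j.1 j.2.+1 *~ (x i * y j).

End RestrictedQuantumGroup.

Arguments Xmod R p a s : clear implicits.
Arguments chi p a s : clear implicits.

(* Main.v *)
Require Import Defs.
From HB Require Import structures.
From mathcomp Require Import all_boot all_order all_algebra.
From mathcomp Require Import boolp reals trigo.
From mathcomp Require Import complex mxtens freeg ring zify.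

(* The traces tr((EF)^i K^j) are additive on short exact sequences, hence define
   functionals on the Grothendieck ring.  On X^alpha(s) both EF and K are diagonal,
   and the pair of eigenvalues of its highest weight vector occurs nowhere else in
   any X^beta(t): the Casimir value determines s up to the exchange of X^alpha(s) and
   X^-alpha(p-s), and K separates these two.  So the classes of the X^alpha(s) are
   independent.  They span, because every nonzero module contains some X^alpha(s):
   a highest weight vector v of weight alpha q^(s-1) generates X^alpha(s) if
   F^s v = 0, and otherwise F^s v generates X^-alpha(p-s).  Hence an identity in the
   Grothendieck ring is an identity between traces.

   For X^+(s) (x) X^+(2), s <= p, a basis making EF triangular and K diagonal gives
   X(s) X(2) = X(s+1) + X(s-1) for s < p, and X(p) X(2) = 2 X(p-1) + 2 X^-(1).
   Therefore X^alpha(s) = X^alpha(1) U_s(X(2)) with U_s the Chebyshev polynomials,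
   X~^+(s) = U_s(X(2)) up to s = 2p - 1, and the fusion rule is the product formula
   for Chebyshev polynomials. *)

Set Implicit Arguments.
Unset Strict Implicit.
Unset Printing Implicit Defensive.

Import Order.TTheory GRing.Theory Num.Theory.

Local Open Scope ring_scope.

(** * Traces and quotients of modules *)

Section Intertwiners.
Variable F : fieldType.

Lemma intertwineX m n (f : 'M[F]_(m, n)) (A : 'M_m) (B : 'M_n) i :
  A *m f = f *m B -> A ^+ i *m f = f *m B ^+ i.
Proof.
move=> AB; elim: i => [|i IH]; first by rewrite !expr0 mulmx1 mul1mx.
by rewrite exprS -mulmxE -mulmxA IH mulmxA AB -mulmxA mulmxE -exprS.
Qed.

(** Writing the identity as [f *m h + k *m g] splits the trace in two; by cyclicity the summands are
    the traces on the subspace and on the quotient. *)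
Lemma mxtrace_intertwine m n l (f : 'M[F]_(n, m)) (g : 'M_(l, n)) h k
    (A K : 'M_n) (A1 K1 : 'M_m) (A2 K2 : 'M_l) i j :
  h *m f = 1%:M -> g *m k = 1%:M -> f *m h + k *m g = 1%:M ->
  A *m f = f *m A1 -> K *m f = f *m K1 ->
  A2 *m g = g *m A -> K2 *m g = g *m K ->
  \tr (A ^+ i *m K ^+ j)
  = \tr (A1 ^+ i *m K1 ^+ j) + \tr (A2 ^+ i *m K2 ^+ j).
Proof.
move=> hf gk fhkg Af Kf gA gK.
rewrite -[X in \tr X]mulmx1 -fhkg mulmxDr mxtraceD; congr (_ + _).
  rewrite mulmxA -(mulmxA (A ^+ i)) (intertwineX j Kf) mulmxA (intertwineX i Af).
  by rewrite mxtrace_mulC 2!mulmxA hf mul1mx.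
rewrite mulmxA mxtrace_mulC 2!mulmxA -(intertwineX i gA) -!mulmxA.
by rewrite (mulmxA g) -(intertwineX j gK) -!mulmxA gk mulmx1.
Qed.

Lemma inj_row_free_tr m n (f : 'M[F]_(m, n)) :
  (forall u : 'cV_n, f *m u = 0 -> u = 0) -> row_free f^T.
Proof.
move=> inj; rewrite -kermx_eq0; apply/eqP/row_matrixP => i.
rewrite row0; apply: trmx_inj; rewrite trmx0; apply: inj; apply: trmx_inj.
by rewrite trmx_mul trmxK trmx0 -row_mul mulmx_ker row0.
Qed.

Lemma diag_mxX n (d : 'rV[F]_n) i : diag_mx d ^+ i = diag_mx (\row_j d 0 j ^+ i).
Proof.
elim: i => [|i IH].
  by rewrite expr0; apply/matrixP => k l; rewrite !mxE expr0.
rewrite exprS IH -mulmxE mulmx_diag; congr diag_mx.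
by apply/rowP => n'; rewrite !mxE exprS.
Qed.

Lemma mxtrace_diagX n (d e : 'rV[F]_n) i j :
  \tr (diag_mx d ^+ i *m diag_mx e ^+ j) = \sum_k d 0 k ^+ i * e 0 k ^+ j.
Proof.
rewrite !diag_mxX mulmx_diag mxtrace_diag.
by apply: eq_bigr => k _; rewrite !mxE.
Qed.

End Intertwiners.

(** * Quotient modules and additivity of the trace moments *)

Section Modules.
Local Open Scope complex_scope.
Variables (R : realType) (p : nat) (hp : (1 < p)%N).
Local Notation C := R[i].
Local Notation Umod := (Umod R p).
Local Notation dim := Defs.dim.

(** Having the right inverse [k], the matrix [g] can be cancelled on the right, so each relation may
    be checked after multiplication by [g], where it is the relation of the original module. *)
Lemma is_rep_quotient m n (g : 'M[C]_(m, n)) k E F K E' F' K' :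
  is_rep p E F K -> g *m k = 1%:M ->
  E' *m g = g *m E -> F' *m g = g *m F -> K' *m g = g *m K ->
  is_rep p E' F' K'.
Proof.
move=> rep gk gE gF gK; have uK := Kop_unit hp rep.
have ginj A B : A *m g = B *m g -> A = B.
  by move=> AB; rewrite -[A]mulmx1 -[B]mulmx1 -gk !mulmxA AB.
have K'V : K' *m (g *m invmx K *m k) = 1%:M.
  by rewrite !mulmxA gK mulmxK.
have uK' : K' \in unitmx by case/mulmx1_unit: K'V.
have gV : invmx K' *m g = g *m invmx K.
  by apply: (can_inj (mulKmx uK')); rewrite mulKVmx // mulmxA gK mulmxK.
case: rep => -[Ep Fp Kp] KE KF EF.
split; [split|..]; apply: (ginj).
- by rewrite (intertwineX _ gE) Ep mulmx0 mul0mx.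
- by rewrite (intertwineX _ gF) Fp mulmx0 mul0mx.
- by rewrite (intertwineX _ gK) Kp mulmx1 mul1mx.
- rewrite -mulmxA gV mulmxA -(mulmxA K') gE mulmxA gK -2!(mulmxA g) KE.
  by rewrite -scalemxAr -scalemxAl gE.
- rewrite -mulmxA gV mulmxA -(mulmxA K') gF mulmxA gK -2!(mulmxA g) KF.
  by rewrite -scalemxAr -scalemxAl gF.
- rewrite mulmxBl -!mulmxA gE gF !mulmxA gE gF -!mulmxA -mulmxBr EF.
  by rewrite -scalemxAr -scalemxAl mulmxBr mulmxBl gK gV.
Qed.

(** The rows of [g] form a basis of the linear forms vanishing on the image of [f], so [g] is the
    projection to the cokernel; an operator [X] induces [g *m X *m k] there. *)
Lemma quotient_exists (N M : Umod) (f : 'M_(dim M, dim N)) :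
  Uhom f -> (forall u : 'cV_(dim N), f *m u = 0 -> u = 0) ->
  exists (Q : Umod) (g : 'M_(dim Q, dim M)), short_exact f g.
Proof.
move=> hf inj; have free := inj_row_free_tr inj.
pose g := row_base (kermx f); pose k := pinvmx g.
have gk : g *m k = 1%:M by rewrite mulmxVp // row_base_free.
have gf : g *m f = 0 by apply/sub_kermxP; rewrite eq_row_base.
have gX (X : 'M_(dim M)) Y : X *m f = f *m Y -> (g *m X *m k) *m g = g *m X.
  move=> XY; rewrite /k mulmxKpV // eq_row_base; apply/sub_kermxP.
  by rewrite -mulmxA XY mulmxA gf mul0mx.
case: (hf) => fE fF fK.
have [gE gF gK] := And3 (gX _ _ (esym fE)) (gX _ _ (esym fF)) (gX _ _ (esym fK)).
have rep := is_rep_quotient (Umod_rep M) gk gE gF gK.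
exists (MkUmod rep), g; split => //=.
- by move=> w; exists (k *m w); rewrite mulmxA gk mul1mx.
move=> v; split=> [gv|[u <-]]; last by rewrite mulmxA gf mul0mx.
have rf : \rank f^T = dim N by apply/eqP.
have rN : (dim N <= dim M)%N by rewrite -rf rank_leq_col.
have sub : (f^T <= kermx g^T)%MS by apply/sub_kermxP; rewrite -trmx_mul gf trmx0.
(* Exactness in the middle by dimension: the image of [f] lies in the kernel of [g], and both have
   dimension [dim N]. *)
have /leqifP := mxrank_leqif_sup sub.
case: ifP => [ker _|_].
  have /submxP[u uE] : (v^T <= f^T)%MS.
    by apply: submx_trans ker; apply/sub_kermxP; rewrite -trmx_mul gv trmx0.
  by exists u^T; apply: trmx_inj; rewrite trmx_mul trmxK -uE.
rewrite mxrank_ker !mxrank_tr eq_row_base mxrank_ker -[in \rank f]mxrank_tr rf.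
by rewrite subKn // ltnn.
Qed.

Definition moment i j (M : Umod) : C :=
  \tr ((Eop M *m Fop M) ^+ i *m Kop M ^+ j).

Lemma moment_ses i j (M' M M'' : Umod) (f : 'M_(dim M, dim M'))
    (g : 'M_(dim M'', dim M)) : short_exact f g ->
  moment i j M = moment i j M' + moment i j M''.
Proof.
case/short_exact_split => -[fE fF fK] [gE gF gK] [h [k [hf gk _ fhkg]]].
apply: (mxtrace_intertwine i j hf gk fhkg) => //.
- by rewrite -mulmxA -fF !mulmxA fE.
- by rewrite -mulmxA -gF !mulmxA gE.
Qed.

End Modules.

(** * The modules X *)

Section RootsOfUnity.
Local Open Scope complex_scope.
Variables (R : realType) (p : nat) (hp : (1 < p)%N).
Local Notation q := (q R p).
Local Notation qint := (qint R p).

Lemma q_powp : q ^+ p = -1.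
Proof.
rewrite cis_expn mulrC divfK ?pnatr_eq0 -?lt0n ?(ltnW hp) // cospi sinpi.
by apply/eqP; rewrite eq_complex /= oppr0 !eqxx.
Qed.

Lemma q_sqr_expz_eq1 (m : int) : q ^ (2 * m) = 1 -> (p %| `|m|)%N.
Proof.
move=> qm; have {qm} : (q ^+ 2) ^+ `|m| = 1.
  rewrite -exprM exprnP PoszM; case: (intP m) qm => [|n|n] //.
  by rewrite abszN mulrN -invr_expz => /(congr1 GRing.inv); rewrite invrK invr1.
have q2p : (q ^+ 2) ^+ p = 1 by rewrite -exprM q_pow2p.
rewrite {1}(divn_eq `|m| p) exprD mulnC exprM q2p expr1n mul1r.
move/eqP; apply: contraTT; rewrite /dvdn -lt0n => r0.
by apply: q2_expn_neq1; rewrite r0 ltn_mod ltnW.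
Qed.

Lemma q_subV_neq0 : q - q^-1 != 0.
Proof.
rewrite subr_eq0; apply/eqP => qV; have := @q2_expn_neq1 R p 1.
by rewrite hp expr1 expr2 {2}qV mulfV ?q_neq0 // eqxx => /(_ isT).
Qed.

Lemma q_sqr_sub1_neq0 : q * q - 1 != 0.
Proof.
apply: contra_neq q_subV_neq0 => qq; apply/eqP; rewrite subr_eq0 -[X in X == _](mulfK (q_neq0 R p)).
by rewrite (subr0_eq qq) mul1r.
Qed.

Lemma qint0 : qint 0 = 0.
Proof. by rewrite /Defs.qint expr0 invr1 subrr mul0r. Qed.

Lemma qint_neq0 n : (0 < n < p)%N -> qint n != 0.
Proof.
move=> np; rewrite mulf_neq0 ?invr_eq0 ?q_subV_neq0 // subr_eq0.
have qn : q ^+ n != 0 by rewrite expf_neq0 ?q_neq0.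
apply/eqP => qV; have := q2_expn_neq1 R np.
by rewrite -exprM mulnC exprM expr2 {2}qV mulfV // eqxx.
Qed.

End RootsOfUnity.

(** * Basis vectors, eigenvalues and irreducibility of the modules X *)

Section Irreducibles.
Local Open Scope complex_scope.
Variables (R : realType) (p : nat) (hp : (1 < p)%N).
Local Notation C := R[i].
Local Notation q := (q R p).
Local Notation qint := (qint R p).
Local Notation Xmod := (Xmod R p).

Lemma XmodE a s (sp : (s <= p)%N) : Xmod a s = MkUmod (X_is_rep R a sp).
Proof.
by rewrite /Defs.Xmod; case: {-}_ / idP => // sp'; rewrite (bool_irrelevance sp' sp).
Qed.

(** [Xweight a s n] is the eigenvalue of [K] on [|n>], and [Xcoef a s n] that of [FE], so
    [Xcoef a s n.+1] is that of [EF]. Both are also evaluated outside the range [n < s <= p], as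
    formal expressions. *)
Definition Xweight (a : bool) s (n : nat) : C := (-1) ^+ a * q ^ (s%:Z - 1 - 2 * n%:Z).
Definition Xcoef (a : bool) s (n : nat) : C := (-1) ^+ a * qint n * qint (s - n).

(* Zero when n >= s. *)
Definition ket s n : 'cV[C]_s := \col_i (i == n :> nat)%:R.

Lemma ket_ord s (i : 'I_s) : ket s i = delta_mx i 0.
Proof. by apply/matrixP => k l; rewrite !mxE ord1 andbT. Qed.

Lemma ket_eq0 s n : (s <= n)%N -> ket s n = 0.
Proof.
by move=> sn; apply/matrixP => k l; rewrite !mxE (ltn_eqF (leq_trans (ltn_ord k) sn)).
Qed.

Lemma ket_sum s (u : 'cV[C]_s) : u = \sum_(i < s) u i 0 *: ket s i.
Proof.
rewrite {1}(matrix_sum_delta u); apply: eq_bigr => i _.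
by rewrite big_ord_recl big_ord0 addr0 ket_ord.
Qed.

Lemma ket_inj m s (A B : 'M[C]_(m, s)) :
  (forall n, (n < s)%N -> A *m ket s n = B *m ket s n) -> A = B.
Proof.
move=> AB; apply/matrixP => i j; have := AB _ (ltn_ord j).
by rewrite ket_ord -!colE => /matrixP/(_ i 0); rewrite !mxE.
Qed.

Lemma X_E_ket a s n : (n < s)%N -> X_E R p a s *m ket s n = Xcoef a s n *: ket s n.-1.
Proof.
move=> ns; rewrite (ket_ord (Ordinal ns)) -colE; apply/matrixP => i j; rewrite !mxE /=.
case: n ns => [|n] ns; first by rewrite /Xcoef qint0 mulr0 !mul0r.
by rewrite eqSS eq_sym; case: eqP; rewrite ?mulr1 ?mulr0.
Qed.

Lemma X_F_ket s n : (n < s)%N -> X_F R s *m ket s n = ket s n.+1.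
Proof.
by move=> ns; rewrite (ket_ord (Ordinal ns)) -colE; apply/matrixP => i j; rewrite !mxE.
Qed.

Lemma X_K_ket a s n : (n < s)%N -> X_K R p a s *m ket s n = Xweight a s n *: ket s n.
Proof.
move=> ns; apply/matrixP => i j; rewrite mul_diag_mx !mxE.
by case: eqP => [->|]; rewrite ?mulr0.
Qed.

Lemma ecoef_neq0 a s n : (s <= p)%N -> (0 < n < s)%N -> Xcoef a s n != 0.
Proof.
move=> sp /andP[n0 ns].
have np : (0 < n < p)%N by rewrite n0 (leq_trans ns).
have snp : (0 < s - n < p)%N.
  by rewrite subn_gt0 ns (leq_trans _ sp) // ltn_subrL n0 (leq_ltn_trans _ ns).
apply: mulf_neq0 (qint_neq0 R hp snp); apply: mulf_neq0 (qint_neq0 R hp np).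
by rewrite signr_eq0.
Qed.

(** Repeated application of [E] carries a nonzero vector of a submodule to a nonzero multiple of
    [|0>], because [E] kills only the line of [|0>]; from [|0>] the powers of [F] give the whole
    basis. *)
Lemma Xmod_irreducible a s : (0 < s <= p)%N -> irreducible (Xmod a s).
Proof.
case/andP=> s0 sp; rewrite (XmodE a sp); split=> // W subW.
have [->|W0] := eqVneq W 0%VS; [by left|right].
(* Induction on a bound [n] for the support of [u], lowered by one by each application of [E]. *)
have in0 n (u : 'cV_s) : (forall i : 'I_s, (n <= i)%N -> u i 0 = 0) -> u != 0 ->
    u \in W -> ket s 0 \in W.
  elim: n u => [|n IH] u un u0 uW.
    by case/eqP: u0; apply/colP => i; rewrite un // mxE.
  have [Eu0|Eu0] := eqVneq (X_E R p a s *m u) 0; last first.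
    apply: (IH _ _ Eu0); last by have [] := subW _ uW.
    move=> i ni; rewrite mxE big1 // => j _; rewrite mxE.
    by case: eqP => [ji|]; rewrite ?mul0r // un ?mulr0 // ji.
  have ui (i : 'I_s) : (0 < i)%N -> u i 0 = 0.
    move=> i0; have ps : (i.-1 < s)%N by rewrite (leq_ltn_trans (leq_pred _)).
    move/matrixP/(_ (Ordinal ps) 0): Eu0; rewrite !mxE (bigD1 i) //= big1.
      rewrite addr0 mxE /= prednK // eqxx => /eqP; rewrite mulf_eq0.
      by rewrite (negbTE (ecoef_neq0 a sp _)) ?i0 //= => /eqP.
    move=> j ji; rewrite mxE /= prednK //.
    by rewrite (_ : (j == i :> nat) = false) ?mul0r //; apply: negbTE.
  have uE : u = u (Ordinal s0) 0 *: ket s 0.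
    apply/colP => i; rewrite !mxE; case: (posnP i) => [i0|i0].
      by rewrite mulr1; congr (u _ _); apply: val_inj.
    by rewrite ui // mulr0.
  have c0 : u (Ordinal s0) 0 != 0.
    by apply: contra_neq u0 => c0; rewrite uE c0 scale0r.
  by rewrite -(scale1r (ket _ _)) -(mulVf c0) -scalerA -uE memvZ.
have k0 : ket s 0 \in W.
  have := memv_pick W; apply: (in0 s); last by rewrite vpick0.
  by move=> i; rewrite leqNgt ltn_ord.
have kn n : ket s n \in W.
  elim: n => // n IH; have [ns|sn] := ltnP n s; last by rewrite ket_eq0 ?mem0v // ltnW.
  by rewrite -X_F_ket //; have [] := subW _ IH.
apply/vspaceP => u; rewrite memvf (ket_sum u).
by apply: memv_suml => i _; exact: memvZ.
Qed.

End Irreducibles.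

(** * The submodule generated by a highest weight vector *)

Section HighestWeight.
Local Open Scope complex_scope.
Variables (R : realType) (p : nat) (hp : (1 < p)%N).
Local Notation C := R[i].
Local Notation q := (q R p).
Local Notation qint := (qint R p).
Local Notation Umod := (Umod R p).
Local Notation dim := Defs.dim.
Local Notation Xmod := (Xmod R p).
Local Notation weight := (Xweight R p).
Local Notation ecoef := (Xcoef R p).

Lemma weightS a s n : weight a s n.+1 = q ^- 2 * weight a s n.
Proof.
rewrite /Xweight mulrCA exprnN -expfzDr ?q_neq0 //; congr (_ * _ ^ _).
by rewrite intS; ring.
Qed.

Lemma weightV a s n :
  (weight a s n)^-1 = (-1) ^+ a * q ^ (- (s%:Z - 1 - 2 * n%:Z)).
Proof. by rewrite /Xweight invfM invr_sign invr_expz. Qed.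

(** This is the relation for [[E, F]] on [|n>], where [EF] and [FE] have the eigenvalues
    [ecoef a s n.+1] and [ecoef a s n]. *)
Lemma ecoefS a s n : (n < s)%N ->
  ecoef a s n.+1 = ecoef a s n
    + (q - q^-1)^-1 * (weight a s n - (weight a s n)^-1).
Proof.
move=> ns; rewrite weightV /Xcoef /Xweight.
have := qint_rec R p (s - n.+1) n.
have -> : (s - n.+1)%N.+1 = (s - n)%N by rewrite subnSK.
have -> : (s - n.+1)%N%:Z - n%:Z = s%:Z - 1 - 2 * n%:Z.
  by rewrite -subzn // intS; ring.
have -> : n%:Z - (s - n.+1)%N%:Z = - (s%:Z - 1 - 2 * n%:Z).
  by rewrite -subzn // intS; ring.
move: (qint n.+1) (qint (s - n.+1)) (qint n) (qint (s - n)) => A B D E.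
by move/eqP; rewrite subr_eq -!mulrA => /eqP ->; ring.
Qed.

Section Vector.
Variables (M : Umod) (v : 'cV[C]_(dim M)) (a : bool) (s : nat).
Hypotheses (Ev : Eop M *m v = 0) (Kv : Kop M *m v = weight a s 0 *: v).

Lemma Kop_Fpow n :
  Kop M *m (Fop M ^+ n *m v) = weight a s n *: (Fop M ^+ n *m v).
Proof.
elim: n => [|n IH]; first by rewrite expr0 mul1mx.
have [_ _ FK _] := rep_comm hp (Umod_rep M).
have q20 : q ^+ 2 != 0 by rewrite expf_neq0 ?q_neq0.
have KF : Kop M *m Fop M = q ^- 2 *: (Fop M *m Kop M).
  by rewrite FK scalerA mulVf // scale1r.
rewrite exprS -mulmxE -mulmxA mulmxA KF -scalemxAl -mulmxA IH -scalemxAr scalerA.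
by rewrite weightS.
Qed.

(** Moving [E] past a further [F] adds the eigenvalue of the commutator, which is the recursion
    [ecoefS]. For [n = s] the coefficient is zero: [F^s v] is again killed by [E]. *)
Lemma Eop_Fpow n : (n <= s)%N ->
  Eop M *m (Fop M ^+ n *m v) = ecoef a s n *: (Fop M ^+ n.-1 *m v).
Proof.
elim: n => [_|n IH ns].
  by rewrite expr0 mul1mx Ev /Xcoef qint0 mulr0 mul0r scale0r.
have KV : invmx (Kop M) *m (Fop M ^+ n *m v) = (weight a s n)^-1 *: (Fop M ^+ n *m v).
  have uK := Kop_unit hp (Umod_rep M).
  have w0 : weight a s n != 0 by rewrite mulf_neq0 ?signr_eq0 // expfz_neq0 ?q_neq0.
  apply: (can_inj (mulKmx uK)); rewrite mulKVmx // -scalemxAr Kop_Fpow scalerA.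
  by rewrite mulVf // scale1r.
case: (Umod_rep M) => _ _ _ /eqP; rewrite subr_eq => /eqP EF.
rewrite {1}exprS -mulmxE -mulmxA mulmxA EF mulmxDl -mulmxA IH ?(ltnW ns) //.
rewrite -scalemxAl mulmxBl Kop_Fpow KV -scalerBl scalerA ecoefS // scalerDl.
rewrite addrC -scalemxAr; congr (_ + _); case: n {IH ns KV} => [|n].
  by rewrite /Xcoef qint0 mulr0 mul0r !scale0r.
by rewrite /= mulmxA mulmxE -exprS.
Qed.

(** The map sends [|n>] to [F^n v]. Its kernel is a submodule of an irreducible module and does not
    contain [|0>], hence is zero. *)
Lemma Xmod_embed : (0 < s <= p)%N -> v != 0 -> Fop M ^+ s *m v = 0 ->
  exists f : 'M_(dim M, dim (Xmod a s)),
    Uhom f /\ forall u : 'cV_(dim (Xmod a s)), f *m u = 0 -> u = 0.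
Proof.
move=> sp v0 Fs; have irr := Xmod_irreducible R hp a sp.
case/andP: sp => s0 sp; rewrite (XmodE R a sp) in irr *.
pose f : 'M[C]_(dim M, s) := \matrix_(i, n) (Fop M ^+ n *m v) i 0.
have fk n : (n <= s)%N -> f *m ket R s n = Fop M ^+ n *m v.
  rewrite leq_eqVlt => /orP[/eqP->|ns]; first by rewrite ket_eq0 // mulmx0 Fs.
  by apply/colP => i; rewrite (ket_ord R (Ordinal ns)) -colE !mxE.
have hf : @Uhom R p (MkUmod (X_is_rep R a sp)) M f.
  split; apply: ket_inj => n ns /=; rewrite -!mulmxA fk ?(ltnW ns) //.
  - rewrite X_E_ket // -scalemxAr fk ?Eop_Fpow ?(ltnW ns) //.
    exact: leq_trans (leq_pred _) (ltnW ns).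
  - by rewrite X_F_ket // fk // exprS -mulmxE mulmxA.
  - by rewrite X_K_ket // -scalemxAr fk ?(ltnW ns) // Kop_Fpow.
exists f; split=> // u fu.
have kerE (x : 'cV[C]_s) : (x \in lker (linfun (mulmx f))) = (f *m x == 0).
  by rewrite memv_ker lfunE.
case: (hf) => /= hE hF hK.
have sub : @submodule R p (MkUmod (X_is_rep R a sp)) (lker (linfun (mulmx f))).
  move=> x; rewrite !kerE => /eqP fx; split; rewrite /= mulmxA ?hE ?hF ?hK //;
    by rewrite -mulmxA fx mulmx0.
have : u \in lker (linfun (mulmx f)) by rewrite (kerE u) fu.
case: irr => _ /(_ _ sub)[-> | WT _]; first by rewrite memv0 => /eqP.
have : ket R s 0 \in lker (linfun (mulmx f)) by rewrite WT memvf.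
by rewrite kerE fk // expr0 mul1mx (negbTE v0).
Qed.

End Vector.
End HighestWeight.

(** * Highest weight vectors *)

Section Separation.
Variables (F : fieldType) (T : finType).

(** By linearity the hypothesis extends to [P.[e t]] for any polynomial [P]; the one chosen vanishes
    at every value of [e] other than [x], so only the fibre over [x] remains. *)
Lemma power_sums_eq0 (w e : T -> F) :
  (forall i : nat, \sum_t w t * e t ^+ i = 0) ->
  forall x, \sum_(t | e t == x) w t = 0.
Proof.
move=> we x; pose P := \prod_(t | e t != x) ('X - (e t)%:P).
have Px : P.[x] != 0.
  rewrite horner_prod prodf_seq_neq0; apply/allP => t _; apply/implyP => tx.
  by rewrite !hornerE subr_eq0 eq_sym.
have Pt t : e t != x -> P.[e t] = 0.
  by move=> tx; rewrite horner_prod (bigD1 t) //= !hornerE subrr mul0r.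
have: \sum_t w t * P.[e t] = 0.
  under eq_bigr do rewrite horner_coef mulr_sumr.
  rewrite exchange_big big1 // => i _; transitivity (P`_i * \sum_t w t * e t ^+ i).
    by rewrite mulr_sumr; apply: eq_bigr => t _; rewrite mulrCA.
  by rewrite we mulr0.
rewrite (bigID (fun t => e t == x)) /= [X in _ + X]big1 => [|t /Pt ->]; last by rewrite mulr0.
rewrite addr0 (eq_bigr (fun t => w t * P.[x])) => [|t /eqP -> //].
by rewrite -mulr_suml => /eqP; rewrite mulf_eq0 (negbTE Px) orbF => /eqP.
Qed.

Lemma moments_eq0 (w e k : T -> F) :
  (forall i j : nat, \sum_t w t * (e t ^+ i * k t ^+ j) = 0) ->
  forall x y, \sum_(t | (e t == x) && (k t == y)) w t = 0.
Proof.
move=> wek x y; rewrite big_mkcondl.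
apply: (power_sums_eq0 (w := fun t => if e t == x then w t else 0)) => j.
transitivity (\sum_(t | e t == x) w t * k t ^+ j).
  by rewrite [RHS]big_mkcond; apply: eq_bigr => t _; case: ifP; rewrite ?mul0r.
apply: power_sums_eq0 => i; rewrite -[RHS](wek i j).
by apply: eq_bigr => t _; rewrite mulrAC mulrA.
Qed.

End Separation.

(** * Embedding of some X into every nonzero module *)

Section Embedding.
Local Open Scope complex_scope.
Variables (R : realType) (p : nat) (hp : (1 < p)%N).
Local Notation C := R[i].
Local Notation q := (q R p).
Local Notation Umod := (Umod R p).
Local Notation dim := Defs.dim.
Local Notation Xmod := (Xmod R p).
Local Notation weight := (Xweight R p).

Lemma q_primitive : (2 * p).-primitive_root q.
Proof.
have [m mq mp] := prim_order_exists (ltn_mul (isT : 0 < 2)%N (ltnW hp)) (q_pow2p R p).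
have /dvdnP[k mE] : (p %| m)%N.
  apply: (@q_sqr_expz_eq1 R p hp m).
  by rewrite mulrC -exprz_exp -exprnP (prim_expr_order mq) exp1rz.
have k1 : k != 1%N.
  apply/eqP => k1; have := prim_expr_order mq; rewrite mE k1 mul1n q_powp // => /eqP.
  by rewrite -subr_eq0 -opprD oppr_eq0 -[1 + 1]/(2%:R) pnatr_eq0.
have m0 := prim_order_gt0 mq.
have k2 : (k <= 2)%N by move: mp; rewrite mE dvdn_pmul2r ?(ltnW hp) //; exact: dvdn_leq.
suff <- : k = 2%N by rewrite -mE.
by move: m0 k1 k2; rewrite mE; case: (k) => [|[|[|]]].
Qed.

Lemma foldr_horner n (K : 'M[C]_n.+1) (v : 'cV_n.+1) (z : nat -> C) s :
  foldr (fun i u => K *m u - z i *: u) v s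
  = horner_mx K (\prod_(i <- s) ('X - (z i)%:P)) *m v.
Proof.
elim: s => [|i s IH]; first by rewrite big_nil rmorph1 mul1mx.
rewrite /= IH big_cons rmorphM rmorphB /= horner_mx_X horner_mx_C -mulmxE.
by rewrite -mulmxA mulmxBl mul_scalar_mx.
Qed.

(** When the factors [K - z i] are applied to [v] one after another, the last nonzero vector is an
    eigenvector; it still satisfies [P], which every factor preserves. *)
Lemma eigenvector_in n (K : 'M[C]_n) (P : 'cV[C]_n -> Prop) (z : nat -> C) s v :
  (forall c u, P u -> P (K *m u - c *: u)) -> P v -> v != 0 ->
  foldr (fun i u => K *m u - z i *: u) v s = 0 ->
  exists2 i, i \in s & exists2 u, P u & u != 0 /\ K *m u = z i *: u.
Proof.
move=> PK Pv v0; elim: s => [|i s IH] /= => [/eqP|]; first by rewrite (negbTE v0).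
set u := foldr _ _ _ in IH *.
have [u0 _|u0 /eqP] := eqVneq u 0.
  by have [j js jP] := IH u0; exists j => //; rewrite inE js orbT.
rewrite subr_eq0 => /eqP Ku; exists i; rewrite ?mem_head //; exists u => //.
by rewrite /u; elim: (s) => //= j r IHr; apply: PK.
Qed.

Lemma nilpotent_kernel n (A : 'M[C]_n) m (v : 'cV[C]_n) :
  A ^+ m = 0 -> v != 0 -> exists2 u : 'cV[C]_n, A *m u = 0 & u != 0.
Proof.
move=> Am; have : A ^+ m *m v = 0 by rewrite Am mul0mx.
move: v => + {Am}.
elim: m => [|m IH] v; first by rewrite expr0 mul1mx => -> /eqP.
have [Av _ v0|Av] := eqVneq (A *m v) 0; first by exists v.
by rewrite exprSr -mulmxE -mulmxA => Amv _; apply: IH Amv Av.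
Qed.

Lemma weight0 a s : weight a s.+1 0 = (-1) ^+ a * q ^+ s.
Proof. by rewrite /Xweight mulr0 subr0 intS addrAC subrr add0r. Qed.

(** The kernel of the nilpotent [E] is nonzero and stable under [K], and [K ^+ (2 * p) - 1] splits
    into the linear factors [K - q ^+ i]; so [K] has an eigenvector in that kernel. *)
Lemma highest_weight_exists (M : Umod) : (0 < dim M)%N ->
  exists (a : bool) s, (0 < s <= p)%N /\ exists v : 'cV_(dim M),
    [/\ v != 0, Eop M *m v = 0 & Kop M *m v = weight a s 0 *: v].
Proof.
case: M => -[//|n] E F K rep _ /=; case: (rep) => -[Ep _ Kp] _ _ _.
have [|v Ev v0] := nilpotent_kernel (v := delta_mx 0 0) Ep.
  by apply/eqP => /matrixP/(_ 0 0); rewrite !mxE eqxx => /eqP; rewrite oner_eq0.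
have [KE _ _ _] := rep_comm hp rep.
have q20 : q ^+ 2 != 0 by rewrite expf_neq0 ?q_neq0.
have PK c (u : 'cV_n.+1) : E *m u = 0 -> E *m (K *m u - c *: u) = 0.
  move=> Eu; rewrite mulmxBr -scalemxAr Eu scaler0 subr0 mulmxA.
  apply: (scalerI q20); rewrite scaler0 scalemxAl -KE -mulmxA Eu mulmx0 //.
have := @eigenvector_in _ K (fun u => E *m u = 0) (fun i => q ^+ i)
  (index_iota 0 (2 * p)) v PK Ev v0.
rewrite foldr_horner.
rewrite (factor_Xn_sub_1 q_primitive) rmorphB rmorphXn rmorph1 /= horner_mx_X Kp subrr mul0mx.
case=> // i; rewrite mem_index_iota => /andP[_ ip] [u Eu [u0 Ku]].
(* For [i < p] the weight [q ^+ i] has sign plus and [s = i + 1]; otherwise it is [- q ^+ (i - p)],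
   so the sign is minus and [s = i - p + 1]. *)
have [ip'|pi] := ltnP i p.
  exists false, i.+1; split=> //; exists u; split=> //.
  by rewrite Ku weight0 mul1r.
exists true, (i - p).+1; split; first by lia.
exists u; split=> //; rewrite Ku weight0 expr1 -(q_powp R hp) -exprD.
by rewrite subnKC.
Qed.

Lemma Xmod_embeds (M : Umod) : (0 < dim M)%N ->
  exists (a : bool) s, (0 < s <= p)%N /\ exists f : 'M_(dim M, dim (Xmod a s)),
    Uhom f /\ forall u : 'cV_(dim (Xmod a s)), f *m u = 0 -> u = 0.
Proof.
move=> /highest_weight_exists[a [s [sp [v [v0 Ev Kv]]]]].
have [Fs|Fs] := eqVneq (Fop M ^+ s *m v) 0.
  by exists a, s; split=> //; apply: (Xmod_embed hp Ev Kv).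
have [[_ Fp _] _ _ _] := Umod_rep M.
have sltp : (s < p)%N.
  case/andP: sp => _; rewrite leq_eqVlt => /orP[/eqP sE|//].
  by move: Fs; rewrite sE Fp mul0mx eqxx.
(* [F^s v] is a highest weight vector for this pair: [E] kills it, its weight is
   [alpha q^(-s-1) = - alpha q^(p-s-1)], and [F^(p-s)] kills it because [F^p = 0]. *)
exists (~~ a), (p - s)%N; split; first by lia.
apply: (Xmod_embed hp _ _ _ Fs).
- by rewrite (Eop_Fpow hp Ev Kv) // /Xcoef subnn qint0 mulr0 scale0r.
- rewrite (Kop_Fpow hp Kv); congr (_ *: _); rewrite /Xweight signrN mulNr -mulrN.
  congr (_ * _); rewrite -[RHS]mulN1r -(q_powp R hp) exprnP -expfzDr ?q_neq0 //.
  rewrite -[LHS]mulr1 -(q_pow2p R p) exprnP -expfzDr ?q_neq0 //; congr (_ ^ _).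
  by rewrite -subzn ?(ltnW sltp) //; lia.
- by lia.
- by rewrite mulmxA mulmxE -exprD subnK ?(ltnW sltp) // Fp mul0mx.
Qed.

End Embedding.

(** * Separation of the irreducible modules *)

Section Characters.
Local Open Scope complex_scope.
Variables (R : realType) (p : nat) (hp : (1 < p)%N).
Local Notation C := R[i].
Local Notation q := (q R p).
Local Notation Xmod := (Xmod R p).
Local Notation weight := (Xweight R p).
Local Notation ecoef := (Xcoef R p).

Lemma moment_Xmod i j a s : (s <= p)%N ->
  moment i j (Xmod a s) = \sum_(n < s) ecoef a s n.+1 ^+ i * weight a s n ^+ j.
Proof.
move=> sp; rewrite /moment (XmodE R a sp) /= X_EF mxtrace_diagX.
by apply: eq_bigr => n _; rewrite !mxE.
Qed.

(** The Casimir element [(q - q^-1)^2 EF + q^-1 K + q K^-1] is a scalar on X^alpha(s). Writing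
    [s = n + m + 1] turns this into a rational identity in [q], [q^n] and [q^m]. *)
Lemma casimir a n m :
  (q - q^-1) ^+ 2 * ecoef a (n + m).+1 n.+1
    + (q^-1 * weight a (n + m).+1 n + q * (weight a (n + m).+1 n)^-1)
  = (-1) ^+ a * (q ^+ (n + m).+1 + q ^- (n + m).+1).
Proof.
rewrite weightV /Xweight /Xcoef subSS addKn /Defs.qint.
have -> : (n + m).+1%:Z - 1 - 2 * n%:Z = m%:Z - n%:Z by lia.
rewrite opprB !expfzDr ?q_neq0 // -!exprnN -!exprnP !exprS !exprD.
have := q_sqr_sub1_neq0 R hp; have q0 := q_neq0 R p; rewrite -invr_sign.
have: q ^+ n != 0 by rewrite expf_neq0.
have: q ^+ m != 0 by rewrite expf_neq0.
move: (q ^+ n) (q ^+ m) ((-1) ^+ a)^-1 (Defs.q R p) q0 => A B c z z0 B0 A0 zz.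
by field; rewrite z0 A0 B0 zz.
Qed.

Lemma q_expz_eq (m n k : int) : m - n = 2 * k -> q ^ m = q ^ n -> (p %| `|k|)%N.
Proof.
move=> mn qmn; apply: (@q_sqr_expz_eq1 R p hp).
by rewrite -mn expfzDr ?q_neq0 // qmn -invr_expz mulfV // expfz_neq0 ?q_neq0.
Qed.

Lemma q_expz_sign_eq (a b : bool) (m n : int) :
  (-1) ^+ a * q ^ m = (-1) ^+ b * q ^ n -> (p %| `|m - n|)%N.
Proof.
move/(congr1 (fun x => x ^+ 2)); rewrite !exprMn !sqrr_sign !mul1r !exprnP !exprz_exp.
by apply: q_expz_eq; ring.
Qed.

Lemma dvdn_small (m : nat) : (p %| m)%N -> (m < p)%N -> m = 0%N.
Proof. by case: m => // m /dvdn_leq -/(_ isT); rewrite leqNgt => /negbTE ->. Qed.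

(** With [u = alpha q^s] and [v = beta q^t], equal Casimir values give [u + u^-1 = v + v^-1], so
    [u = v] or [u v = 1]; the weights then settle both cases. *)
Lemma highest_weight_sep a b s t n : (0 < s <= p)%N -> (0 < t <= p)%N -> (n < s)%N ->
  ecoef a s n.+1 = ecoef b t 1 -> weight a s n = weight b t 0 ->
  [/\ n = 0%N, a = b & s = t].
Proof.
move=> /andP[_ sp] /andP[t0 tp] ns ee ww.
have sE : s = (n + (s - n.+1)).+1 by rewrite -addSn subnKC.
have tE : t = (0 + t.-1).+1 by rewrite add0n prednK.
have := casimir b 0 t.-1; rewrite -tE -ee -ww {1 2 3}sE casimir -sE => {ee sE tE}.
have q0 := q_neq0 R p.
move=> uv; have [uvE|uvE] : (-1) ^+ a * q ^+ s = (-1) ^+ b * q ^+ t \/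
     ((-1) ^+ a * q ^+ s) * ((-1) ^+ b * q ^+ t) = 1.
- set u := (-1) ^+ a * q ^+ s; set v := (-1) ^+ b * q ^+ t.
  have u0 : u != 0 by rewrite mulf_neq0 ?signr_eq0 ?expf_neq0.
  have v0 : v != 0 by rewrite mulf_neq0 ?signr_eq0 ?expf_neq0.
  have {}uv : u + u^-1 = v + v^-1.
    by rewrite /u /v !invfM !invr_sign -!mulrDr.
  have : (u - v) * (u * v - 1) = 0.
    have -> : (u - v) * (u * v - 1) = u * v * (u + u^-1 - (v + v^-1)).
      by field; rewrite u0 v0.
    by rewrite uv subrr mulr0.
  by move/eqP; rewrite mulf_eq0 !subr_eq0 => /orP[/eqP|/eqP]; [left|right].
- have st : s = t by move: uvE; rewrite !exprnP => /q_expz_sign_eq/dvdn_small; lia.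
  move: uvE; rewrite st => /(mulIf (expf_neq0 _ q0)) ab.
  have {}ab : a = b by exact: signr_inj ab.
  have b0 : (-1) ^+ b != 0 :> C by rewrite signr_eq0.
  move: ww; rewrite /Xweight st ab => /(mulfI b0).
  have nn : t%:Z - 1 - 2 * n%:Z - (t%:Z - 1 - 2 * 0%:Z) = 2 * (- n%:Z) by ring.
  by move/(q_expz_eq nn)/dvdn_small => n0; split=> //; lia.
(* In the case [u v = 1], [p] divides [s + t], and by the weights also [t + n], hence [s - n]. As
   [0 < s - n <= p], this forces [n = 0] and [s = t = p]. *)
have {}uvE : (-1) ^+ a * q ^ s%:Z = (-1) ^+ b * q ^ (- t%:Z).
  rewrite -invr_expz -exprnP -[(-1) ^+ b]invr_sign -invfM.
  apply: (mulIf (_ : (-1) ^+ b * q ^+ t != 0)); first by rewrite mulf_neq0 ?signr_eq0 ?expf_neq0.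
  by rewrite uvE mulVf // mulf_neq0 ?signr_eq0 ?expf_neq0.
have kE := q_expz_sign_eq uvE.
have : q ^ (- t%:Z - 1 - 2 * n%:Z) = q ^ (t%:Z - 1).
  have b0 : (-1) ^+ b != 0 :> C by rewrite signr_eq0.
  apply: (mulfI b0); rewrite -[t%:Z - 1]subr0 -[0 in RHS](mulr0 2).
  by rewrite -[RHS]ww /Xweight -!addrA expfzDr // mulrA -uvE -mulrA -expfzDr.
have tn : - t%:Z - 1 - 2 * n%:Z - (t%:Z - 1) = 2 * (- t%:Z - n%:Z) by ring.
move/(q_expz_eq tn) => pl; have {}pl : (p %| t + n)%N by move: pl; congr (_ %| _)%N; lia.
have pk : (p %| s + t)%N by move: kE; congr (_ %| _)%N; lia.
have psn : (p %| s - n)%N.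
  by rewrite (_ : s - n = s + t - (t + n))%N ?dvdn_sub //; lia.
have snp : (s - n = p)%N.
  have := dvdn_leq _ psn; lia.
have n0 : n = 0%N by lia.
have sp' : s = p by lia.
have tp' : t = p.
  by rewrite n0 addn0 in pl; have := dvdn_leq t0 pl; lia.
split=> //; last by rewrite tp'.
move: uvE; rewrite sp' tp' -invr_expz -exprnP q_powp // invrN1 => /(mulIf _) ab.
by apply: signr_inj; apply: ab; rewrite oppr_eq0 oner_eq0.
Qed.

End Characters.

(** * The Grothendieck group *)

Section Grothendieck.
Local Open Scope complex_scope.
Local Open Scope quotient_scope.
Variables (R : realType) (p : nat) (hp : (1 < p)%N).
Local Notation C := R[i].
Local Notation Umod := (Umod R p).
Local Notation dim := Defs.dim.
Local Notation Xmod := (Xmod R p).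
Local Notation weight := (Xweight R p).
Local Notation ecoef := (Xcoef R p).
Local Notation FG := {freeg Umod / int}.
Local Notation K0 := (K0 R hp).

Definition FGmoment i j (x : FG) : C :=
  fglift (fun M => moment i j M : zmodule C) x.

Lemma FGmoment_gen i j M : FGmoment i j << M >> = moment i j M.
Proof. by rewrite /FGmoment liftU scale1r. Qed.

Lemma FGmomentB i j x y : FGmoment i j (x - y) = FGmoment i j x - FGmoment i j y.
Proof. by rewrite /FGmoment lift_is_additive. Qed.

Lemma FGmoment_ses i j x : ses_span x -> FGmoment i j x = 0.
Proof.
elim=> [|{}x y _ IH _ IH'|M' M M'' f g fg].
- by rewrite -[X in FGmoment _ _ X](subrr 0) FGmomentB subrr.
- by rewrite FGmomentB IH IH' subrr.
by rewrite !FGmomentB !FGmoment_gen (moment_ses i j fg) -addrA -opprD subrr.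
Qed.

Definition K0moment i j (x : K0) : C :=
  FGmoment i j (repr (x : {ideal_quot (@ses_pred R p)})).

Lemma K0moment_pi i j x : K0moment i j (\pi_{ideal_quot (@ses_pred R p)} x) = FGmoment i j x.
Proof.
apply/eqP; rewrite -subr_eq0 -FGmomentB; apply/eqP/FGmoment_ses/asboolP.
have := @reprK _ {ideal_quot (@ses_pred R p)} (\pi x).
by move/eqP; rewrite -Quotient.idealrBE.
Qed.

Lemma K0moment_is_additive i j : zmod_morphism (K0moment i j).
Proof.
elim/K0_ind => x; elim/K0_ind => y.
by rewrite pi_K0B !K0moment_pi FGmomentB.
Qed.

HB.instance Definition _ i j :=
  GRing.isZmodMorphism.Build K0 C (K0moment i j) (K0moment_is_additive i j).

Local Notation cl := (K0class hp).

Lemma K0moment_class i j M : K0moment i j (cl M) = moment i j M.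
Proof. by rewrite K0moment_pi FGmoment_gen. Qed.

Lemma K0class_ses (M' M M'' : Umod) (f : 'M_(dim M, dim M')) (g : 'M_(dim M'', dim M)) :
  short_exact f g -> cl M = cl M' + cl M''.
Proof.
move=> fg; rewrite pi_K0D; apply/eqP; rewrite -Quotient.idealrBE opprD addrA.
exact/asboolP/ses_span_ses/fg.
Qed.

Local Notation X := (fun i : bool * 'I_p => Xmod i.1 i.2.+1).

Definition lincomb (c : fusion p) : K0 := \sum_i cl (X i) *~ c i.

Lemma lincomb_is_additive : zmod_morphism lincomb.
Proof.
by move=> c d; rewrite -sumrB; apply: eq_bigr => i _; rewrite !ffunE mulrzBr.
Qed.

HB.instance Definition _ :=
  GRing.isZmodMorphism.Build (fusion p) K0 lincomb lincomb_is_additive.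

Lemma K0moment_Xmod i j a s : (s <= p)%N ->
  K0moment i j (cl (Xmod a s))
  = \sum_(n < p | (n < s)%N) ecoef a s n.+1 ^+ i * weight a s n ^+ j.
Proof.
move=> sp; rewrite K0moment_class moment_Xmod //.
by rewrite (big_ord_widen _ (fun n => ecoef a s n.+1 ^+ i * weight a s n ^+ j) sp).
Qed.

(** At the pair of eigenvalues of the highest weight vector of one X, [highest_weight_sep] leaves a
    single term in [moments_eq0], namely the coefficient of that X. *)
Lemma lincomb_moments_eq0 c : (forall i j, K0moment i j (lincomb c) = 0) -> c = 0.
Proof.
move=> c0; apply/ffunP => -[b t]; rewrite [RHS]ffunE.
pose T : finType := ((bool * 'I_p) * 'I_p)%type.
(* The basis vectors of all the X are indexed by one finite type; [w] is zero at the indices beyond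
   the dimension of the module. *)
pose w (z : T) : C := if (z.2 <= z.1.2)%N then (c z.1)%:~R else 0.
pose e (z : T) := ecoef z.1.1 z.1.2.+1 z.2.+1.
pose k (z : T) := weight z.1.1 z.1.2.+1 z.2.
have p0 : (0 < p)%N by exact: ltnW.
have /moments_eq0/(_ (e ((b, t), Ordinal p0)) (k ((b, t), Ordinal p0))) :
    forall i j, \sum_z w z * (e z ^+ i * k z ^+ j) = 0.
  move=> i j; rewrite -[RHS](c0 i j) raddf_sum /=.
  rewrite -(pair_bigA _ (fun x n => w (x, n) * (e (x, n) ^+ i * k (x, n) ^+ j))) /=.
  apply: eq_bigr => x _; rewrite raddfMz /= K0moment_Xmod ?ltn_ord //.
  rewrite [in RHS]big_mkcond -mulrzl mulr_sumr; apply: eq_bigr => n _.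
  by rewrite /w /= ltnS; case: ifP; rewrite ?mul0r ?mulr0.
rewrite (bigD1 ((b, t), Ordinal p0)) ?eqxx //= big1 => [|[[b' t'] n] /=].
  by rewrite /w /= addr0 => /eqP; rewrite intr_eq0 => /eqP.
case/andP=> /andP[/eqP ee /eqP kk] ne; rewrite /w /=; case: ifP => // nt.
have [n0 bE tE] := highest_weight_sep hp (ltn_ord t' : 0 < t'.+1 <= p)%N
  (ltn_ord t : 0 < t.+1 <= p)%N (nt : (n < t'.+1)%N) ee kk.
case/eqP: ne; move: n0 bE tE => /= n0 -> [tE].
by congr (_, _, _); apply: val_inj.
Qed.

(** Identity matrices give an exact sequence [0 -> M -> M -> M -> 0], so the class equals twice
    itself. *)
Lemma K0class_dim0 (M : Umod) : dim M = 0%N -> cl M = 0.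
Proof.
move=> M0; apply/(addrI (cl M)); rewrite addr0; apply/esym.
have z m n (A B : 'M[C]_(m, n)) : n = 0%N -> A = B.
  by move=> n0; apply/matrixP => i j; case: j => j jn; exfalso; rewrite n0 in jn.
have zr m n (A B : 'M[C]_(m, n)) : m = 0%N -> A = B.
  by move=> m0; apply/matrixP => i j; case: i => i im; exfalso; rewrite m0 in im.
apply: (@K0class_ses M M M 1%:M 1%:M); split; try by split; apply: z.
- by move=> u _; apply: zr.
- by move=> u; exists 0; apply: zr.
- by move=> v; split=> _; [exists 0|]; apply: zr.
Qed.

Lemma dim_Xmod a s : (s <= p)%N -> dim (Xmod a s) = s.
Proof. by move=> sp; rewrite (XmodE R a sp). Qed.

Lemma dim_ses (M' M M'' : Umod) (f : 'M_(dim M, dim M')) (g : 'M_(dim M'', dim M)) :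
  short_exact f g -> dim M = (dim M' + dim M'')%N.
Proof.
move/(moment_ses 0 0); rewrite /moment !expr0 !mulmx1 !mxtrace1 -natrD.
by move/eqP; rewrite eqr_nat => /eqP.
Qed.

Lemma chi_lincomb a s : (0 < s <= p)%N -> lincomb (chi p a s) = cl (Xmod a s).
Proof.
case: s => // s sp; rewrite /lincomb (bigD1 (a, Ordinal sp)) //= big1.
  by rewrite ffunE /= !eqxx addr0.
move=> -[b t] ne; rewrite ffunE /= eqSS; case: eqP => // bE; case: eqP => //= tE.
by case/eqP: ne; rewrite bE; congr (_, _); apply: val_inj.
Qed.

Lemma class_lincomb (M : Umod) : exists c, cl M = lincomb c.
Proof.
have [n] := ubnP (dim M); elim: n M => // n IH M; rewrite ltnS => Mn.
have [M0|M0] := posnP (dim M); first by exists 0; rewrite raddf0 K0class_dim0.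
have [a [s [sp [f [hf finj]]]]] := Xmod_embeds hp M0.
have [Q [g fg]] := quotient_exists hp hf finj.
have [|c cE] := IH Q.
  move: (dim_ses fg); rewrite dim_Xmod; last by case/andP: sp.
  by case/andP: sp => *; lia.
by exists (chi p a s + c); rewrite raddfD /= -cE chi_lincomb // (K0class_ses fg).
Qed.

Lemma lincomb_surj x : exists c, x = lincomb c.
Proof.
elim/K0_ind: x => x; elim/FG_ind: x => [|x y [c cE] [d dE]|M].
- by exists 0; rewrite !raddf0.
- by exists (c - d); rewrite [RHS]raddfB /= -cE -dE pi_K0B.
exact: class_lincomb.
Qed.

(** The difference is an integral combination of classes of the X with all moments zero, so it
    vanishes. *)
Lemma K0_eqP (x y : K0) : (forall i j, K0moment i j x = K0moment i j y) -> x = y.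
Proof.
move=> xy; apply/subr0_eq; have [c cE] := lincomb_surj (x - y).
rewrite cE (@lincomb_moments_eq0 c) ?raddf0 // => i j.
by rewrite -cE raddfB /= xy subrr.
Qed.

Lemma lincomb_inj : injective lincomb.
Proof.
move=> c d cd; apply/subr0_eq/lincomb_moments_eq0 => i j.
by rewrite raddfB /= cd subrr raddf0.
Qed.

Lemma K0class_iso (M N : Umod) : Uiso M N -> cl M = cl N.
Proof.
case=> f [g [[fE fF fK] gf fg]]; apply: K0_eqP => i j; rewrite !K0moment_class /moment.
have conj (A B : 'M_(_)) : f *m A = B *m f -> \tr A = \tr B.
  by move=> AB; rewrite -[B]mulmx1 -fg mulmxA -AB mxtrace_mulC mulmxA gf mul1mx.
have fEF : (Eop N *m Fop N) *m f = f *m (Eop M *m Fop M).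
  by rewrite -mulmxA -fF !mulmxA fE.
apply: conj; rewrite mulmxA -(intertwineX i fEF) -!mulmxA.
by rewrite (intertwineX j (esym fK)).
Qed.

(** * Classification of the irreducible modules *)

Lemma irreducible_surj (N M : Umod) (f : 'M_(dim M, dim N)) :
  irreducible M -> Uhom f -> f != 0 -> forall v : 'cV_(dim M), exists u, f *m u = v.
Proof.
move=> [_ irr] [fE fF fK] f0; pose W := limg (linfun (mulmx f : 'cV_(dim N) -> 'cV_(dim M))).
have WP v : reflect (exists u, f *m u = v) (v \in W).
  apply: (iffP memv_imgP) => [[u _ ->]|[u <-]]; first by exists u; rewrite lfunE.
  by exists u; rewrite ?memvf ?lfunE.
have /irr[W0|WT] : submodule W.
  move=> v /WP[u <-]; split; apply/WP.
  - by exists (Eop N *m u); rewrite !mulmxA fE.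
  - by exists (Fop N *m u); rewrite !mulmxA fF.
  - by exists (Kop N *m u); rewrite !mulmxA fK.
- case/eqP: f0; apply/matrixP => i j; rewrite mxE.
  have : f *m delta_mx j 0 \in W by apply/WP; eexists.
  by rewrite W0 memv0 -colE => /eqP/matrixP/(_ i 0); rewrite !mxE.
by move=> v; apply/WP; rewrite WT memvf.
Qed.

Lemma bijective_Uiso (N M : Umod) (f : 'M_(dim M, dim N)) :
  Uhom f -> (forall u : 'cV_(dim N), f *m u = 0 -> u = 0) ->
  (forall v : 'cV_(dim M), exists u, f *m u = v) -> Uiso M N.
Proof.
move=> [fE fF fK] inj surj.
have [g gE] := fin_all_exists (fun j => surj (delta_mx j 0)).
pose g' : 'M_(dim N, dim M) := \matrix_(i, j) g j i 0.
have fg : f *m g' = 1%:M.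
  apply/matrixP => i j; have /matrixP/(_ i 0) := gE j.
  by rewrite !mxE eqxx andbT => <-; apply: eq_bigr => l _; rewrite mxE.
have finj m (A B : 'M_(dim N, m)) : f *m A = f *m B -> A = B.
  move=> AB; apply/subr0_eq/matrixP => i j.
  have : (A - B) *m delta_mx j (0 : 'I_1) = 0.
    by apply: inj; rewrite mulmxA mulmxBr AB subrr mul0mx.
  by rewrite -colE => /matrixP/(_ i 0); rewrite !mxE.
have gf : g' *m f = 1%:M by apply: finj; rewrite mulmxA fg mul1mx mulmx1.
have comm A B : f *m A = B *m f -> g' *m B = A *m g'.
  by move=> AB; rewrite -[A]mul1mx -gf -(mulmxA g') AB -!mulmxA fg mulmx1.
by exists g', f; split=> //; split; apply: comm.
Qed.

(** The embedding of some X is onto because [M] is irreducible. Uniqueness: isomorphic modules have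
    equal classes, and the classes of the X are independent. *)
Lemma irreducible_Xmod (M : Umod) : irreducible M ->
  exists! x : bool * 'I_p, Uiso M (X x).
Proof.
move=> irr; have [M0 _] := irr.
have [a [s [sp [f [hf finj]]]]] := Xmod_embeds hp M0.
case: s sp f hf finj => // s /= sp f hf finj.
have iso : Uiso M (X (a, Ordinal sp)).
  apply: (bijective_Uiso hf finj); apply: irreducible_surj hf _ => //.
  apply/eqP => f0; have := finj (const_mx 1); rewrite f0 mul0mx => /(_ erefl)/matrixP.
  have s0 : (0 < dim (Xmod a s.+1))%N by rewrite dim_Xmod.
  by move/(_ (Ordinal s0) 0); rewrite !mxE => /eqP; rewrite oner_eq0.
exists (a, Ordinal sp); split=> // -[b t] /K0class_iso /= bt.
have := K0class_iso iso; rewrite bt /= -!chi_lincomb ?ltn_ord // => /lincomb_inj.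
move/ffunP/(_ (b, t)); rewrite !ffunE /= !eqxx => /eqP.
rewrite eqSS; case: (boolP ((b == a) && (t == s :> nat))) => // /andP[/eqP-> /eqP ts] _.
by congr (_, _); apply: val_inj.
Qed.

End Grothendieck.

(** * Tensor products with X(1) and X(2) *)

Section TensorTrace.
Variable L : fieldType.

Lemma mxtrace_tens m n (A : 'M[L]_m) (B : 'M_n) : \tr (A *t B) = \tr A * \tr B.
Proof. by rewrite /mxtrace mulr_sum; apply: eq_bigr => i _; rewrite mxE. Qed.

(** Stability of the image of [f] under [A] and [K] makes [g *m A *m k] and [g *m K *m k] the
    operators induced on the quotient. *)
Lemma mxtrace_flag m n l (f : 'M[L]_(n, m)) (g : 'M_(l, n)) h k
    (A K : 'M_n) (A1 K1 : 'M_m) i j :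
  h *m f = 1%:M -> g *m k = 1%:M -> g *m f = 0 -> f *m h + k *m g = 1%:M ->
  A *m f = f *m A1 -> K *m f = f *m K1 ->
  \tr (A ^+ i *m K ^+ j)
  = \tr (A1 ^+ i *m K1 ^+ j) + \tr ((g *m A *m k) ^+ i *m (g *m K *m k) ^+ j).
Proof.
move=> hf gk gf fhkg Af Kf.
have quo (Y : 'M_n) Y1 : Y *m f = f *m Y1 -> (g *m Y *m k) *m g = g *m Y.
  move=> Yf; rewrite -[RHS]mulmx1 -fhkg mulmxDr -!mulmxA (mulmxA Y f) Yf.
  by rewrite (mulmxA g (f *m _)) (mulmxA g f) gf !mul0mx add0r.
exact: mxtrace_intertwine hf gk fhkg Af Kf (quo _ _ Af) (quo _ _ Kf).
Qed.

(* V stands for K^-1, and the equations on S say that the image of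
   1 (x) e0 + S (x) e1 is stable under Delta(E) Delta(F) and Delta(K). *)
Lemma mxtrace_tens2 s (E F V K S : 'M[L]_s) (E' F' K' : 'M_2) (e0 e1 : 'cV_2) z
    (d1 d2 k1 k2 : 'rV_s) i j :
  e0^T *m e0 = 1%:M -> e1^T *m e1 = 1%:M -> e0^T *m e1 = 0 -> e1^T *m e0 = 0 ->
  e0 *m e0^T + e1 *m e1^T = 1%:M ->
  E' *m e0 = 0 -> E' *m e1 = e0 -> F' *m e0 = e1 -> F' *m e1 = 0 ->
  K' *m e0 = z *: e0 -> K' *m e1 = z^-1 *: e1 ->
  z^-1 *: (E *m V + E *m F *m S) = S *m (V + z *: (E *m F) + F *m S) ->
  z^-1 *: (K *m S) = z *: (S *m K) ->
  V + z *: (E *m F) + F *m S = diag_mx d1 -> z^-1 *: (E *m F) - S *m F = diag_mx d2 ->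
  z *: K = diag_mx k1 -> z^-1 *: K = diag_mx k2 ->
  \tr (((1%:M *t E' + E *t K') *m (V *t F' + F *t 1%:M)) ^+ i *m (K *t K') ^+ j)
  = \sum_n d1 0 n ^+ i * k1 0 n ^+ j + \sum_n d2 0 n ^+ i * k2 0 n ^+ j.
Proof.
move=> o00 o11 o01 o10 oo E20 E21 F20 F21 K20 K21 off KS D1E D2E K1E K2E.
set A := _ *m (V *t _ + _).
have A0 : A *m (1%:M *t e0) = (V + z *: (E *m F)) *t e0 + (z^-1 *: (E *m V)) *t e1.
  rewrite /A -mulmxA [X in _ *m X]mulmxDl !tensmx_mul !mulmx1 F20 mul1mx.
  rewrite mulmxDl !mulmxDr !tensmx_mul !mul1mx E21 E20 K21 K20 tensmx0 addr0.
  by rewrite !tensmxZr tensmxDl !tensmxZl addrCA addrC.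
have A1 m (Y : 'M_(s, m)) :
    A *m (Y *t e1) = (F *m Y) *t e0 + (z^-1 *: (E *m F *m Y)) *t e1.
  rewrite /A -mulmxA [X in _ *m X]mulmxDl !tensmx_mul F21 mul1mx tensmx0 add0r.
  by rewrite mulmxDl !tensmx_mul !mul1mx E21 K21 tensmxZr tensmxZl mulmxA.
(* Vectors are decomposed into [x (x) e0 + S x (x) e1], which form the stable subspace, and
   [y (x) e1]; [h] and [g] read off [x] and [y]. *)
pose f := 1%:M *t e0 + S *t e1; pose h := (1%:M : 'M[L]_s) *t e0^T.
pose g := 1%:M *t e1^T - S *t e0^T; pose k := (1%:M : 'M[L]_s) *t e1.
have hf : h *m f = 1%:M.
  by rewrite mulmxDr !tensmx_mul o00 o01 tensmx0 addr0 mulmx1 tensmx11.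
have gk : g *m k = 1%:M.
  by rewrite mulmxBl !tensmx_mul o11 o01 tensmx0 subr0 mulmx1 tensmx11.
have gf : g *m f = 0.
  rewrite mulmxBl !mulmxDr !tensmx_mul o11 o01 o00 o10 !tensmx0 add0r addr0.
  by rewrite mulmx1 mul1mx subrr.
have fhkg : f *m h + k *m g = 1%:M.
  rewrite mulmxDl mulmxBr !tensmx_mul !mul1mx !mulmx1 addrAC.
  by rewrite [X in X + _ = _]addrA -tensmxDr oo tensmx11 subrK.
have Af : A *m f = f *m ((V + z *: (E *m F) + F *m S) *t 1%:M).
  rewrite mulmxDr A0 A1 [RHS]mulmxDl !tensmx_mul mul1mx !mulmx1 -off.
  by rewrite addrACA -!tensmxDl scalerDr.
have Kf : (K *t K') *m f = f *m ((z *: K) *t 1%:M).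
  rewrite mulmxDr [RHS]mulmxDl !tensmx_mul mul1mx !mulmx1 K20 K21 !tensmxZr.
  by rewrite -!tensmxZl KS -scalemxAr.
rewrite (mxtrace_flag i j hf gk gf fhkg Af Kf).
have -> : g *m A *m k = (z^-1 *: (E *m F) - S *m F) *t 1%:M.
  rewrite -mulmxA A1 !mulmx1 mulmxBl !mulmxDr !tensmx_mul o10 o11 o00 o01 !tensmx0.
  by rewrite mul1mx add0r addr0 -tensmxNl -tensmxDl.
have -> : g *m (K *t K') *m k = (z^-1 *: K) *t 1%:M.
  rewrite -mulmxA tensmx_mul mulmx1 K21 mulmxBl !tensmx_mul -!scalemxAr o11 o01.
  by rewrite scaler0 tensmx0 subr0 mul1mx tensmxZr tensmxZl.
rewrite !tensmxX !tensmx_mul !mxtrace_tens !expr1n mulmx1 mxtrace1 !mulr1.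
by rewrite D1E D2E K1E K2E !mxtrace_diagX.
Qed.

End TensorTrace.

Section TensorMoments.
Local Open Scope complex_scope.
Variables (R : realType) (p : nat) (hp : (1 < p)%N).
Local Notation C := R[i].
Local Notation q := (q R p).
Local Notation qint := (qint R p).
Local Notation Xmod := (Xmod R p).
Local Notation weight := (Xweight R p).
Local Notation ecoef := (Xcoef R p).
Local Notation ket := (ket R).

Lemma X_E1 a : X_E R p a 1 = 0.
Proof. by apply/matrixP => i j; rewrite !mxE !ord1. Qed.

Lemma X_F1 : X_F R 1 = 0.
Proof. by apply/matrixP => i j; rewrite !mxE !ord1. Qed.

Lemma X_K1 a : X_K R p a 1 = ((-1) ^+ a)%:M.
Proof. by apply/matrixP => i j; rewrite !mxE !ord1 /= mulr0 !subr0 subrr mulr1. Qed.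

Lemma X_KV1 a : invmx (X_K R p a 1) = ((-1) ^+ a)%:M.
Proof. by rewrite X_K1 invmx_scalar invr_sign. Qed.

Lemma scalar_mxX n (c : C) i : (c%:M : 'M_n) ^+ i = (c ^+ i)%:M.
Proof.
elim: i => [|i IH]; first by rewrite !expr0.
by rewrite exprS IH -mulmxE -scalar_mxM exprS.
Qed.

Lemma moment_Xmod_sign i j a b s : (s <= p)%N ->
  moment i j (Xmod (a (+) b) s)
  = ((-1) ^+ a) ^+ i * ((-1) ^+ a) ^+ j * moment i j (Xmod b s).
Proof.
move=> sp; rewrite !moment_Xmod // mulr_sumr; apply: eq_bigr => n _.
rewrite /Xcoef /Xweight signr_addb !exprMn.
move: (_ ^+ i) (_ ^+ i) (_ ^+ i) (_ ^+ i) => x y z t; ring.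
Qed.

(** On X^alpha(1) both [E] and [F] are zero and [K] is the sign, so on the product [EF] and [K] are
    those of the other factor times this sign. *)
Lemma moment_tens1l i j a b s : (s <= p)%N ->
  moment i j (tens hp (Xmod a 1) (Xmod b s)) = moment i j (Xmod (a (+) b) s).
Proof.
move=> sp; rewrite moment_Xmod_sign // /moment (XmodE R a (ltnW hp)) (XmodE R b sp) /=.
rewrite X_E1 X_F1 X_KV1 X_K1 !tens0mx !addr0 tensmx_mul mul1mx !tensmxX tensmx_mul.
by rewrite mxtrace_tens !scalar_mxX -scalar_mxM mxtrace_scalar mulr1n.
Qed.

Lemma moment_tens1r i j a b s : (s <= p)%N ->
  moment i j (tens hp (Xmod b s) (Xmod a 1)) = moment i j (Xmod (a (+) b) s).
Proof.
move=> sp; rewrite moment_Xmod_sign // /moment (XmodE R a (ltnW hp)) (XmodE R b sp) /=.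
rewrite X_E1 X_F1 X_K1 !tensmx0 !add0r tensmx_mul mulmx1 !tensmxX tensmx_mul.
by rewrite mxtrace_tens !scalar_mxX -scalar_mxM mxtrace_scalar mulr1n mulrC.
Qed.

Lemma diag_ket s (d : nat -> C) n :
  diag_mx (\row_(i < s) d i) *m ket s n = d n *: ket s n.
Proof.
apply/matrixP => i j; rewrite mul_diag_mx !mxE.
by case: eqP => [->|]; rewrite ?mulr0.
Qed.

(* r is chosen so that the vectors |n> (x) |0> + r(n) |n-1> (x) |1> of X(s) (x) X(2)
   are eigenvectors of EF, including when EF is not diagonalizable. *)
Definition shiftcoef s (n : nat) : C := q ^ (n%:Z - s%:Z) * qint n.
Definition shiftmx s : 'M[C]_s :=
  \matrix_(m, n) if n == m.+1 :> nat then shiftcoef s n else 0.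

Lemma shiftmx_ket s n : (n < s)%N -> shiftmx s *m ket s n = shiftcoef s n *: ket s n.-1.
Proof.
move=> ns; rewrite (ket_ord R (Ordinal ns)) -colE; apply/matrixP => i j; rewrite !mxE /=.
case: n ns => [|n] ns; first by rewrite /shiftcoef qint0 mulr0 mul0r.
by rewrite eqSS eq_sym; case: eqP; rewrite ?mulr1 ?mulr0.
Qed.

Local Notation e0 := (ket 2 0).
Local Notation e1 := (ket 2 1).

Lemma X_E2_ket : X_E R p false 2 *m e0 = 0 /\ X_E R p false 2 *m e1 = e0.
Proof.
rewrite !X_E_ket //= /Xcoef !mul1r qint0 mul0r scale0r; split=> //.
by rewrite /Defs.qint expr1 divff ?q_subV_neq0 // mulr1 scale1r.
Qed.

Lemma X_F2_ket : X_F R 2 *m e0 = e1 /\ X_F R 2 *m e1 = 0.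
Proof. by rewrite !X_F_ket // (@ket_eq0 _ 2 2). Qed.

Lemma X_K2_ket : X_K R p false 2 *m e0 = q *: e0 /\ X_K R p false 2 *m e1 = q^-1 *: e1.
Proof. by rewrite !X_K_ket // /Xweight !mul1r. Qed.

(** * The product of X(s) and X(2), with [EF] in triangular form *)

Section TensorWithX2.
Variable s : nat.
Local Notation E := (X_E R p false s).
Local Notation F := (X_F R s).
Local Notation K := (X_K R p false s).
Local Notation S := (shiftmx s).
Local Notation d1 := (fun n : nat => ecoef false s.+1 n.+1).
Local Notation d2 := (fun n : nat => ecoef false s.-1 n.+1).

Lemma invK_ket n : (n < s)%N -> invmx K *m ket s n = (weight false s n)^-1 *: ket s n.
Proof.
move=> ns; rewrite X_KV weightV.
by rewrite (@diag_ket s (fun n => (-1) ^+ false * q ^ (- (s%:Z - 1 - 2 * n%:Z)))).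
Qed.

(** The component along [|n> (x) |0>] of [EF] applied to [|n> (x) |0> + r(n) |n-1> (x) |1>]; the
    eigenvalue is that of [|n>] in X(s+1). *)
Lemma d1_coef n : (n < s)%N ->
  (weight false s n)^-1 + q * ecoef false s n.+1 + shiftcoef s n = d1 n.
Proof.
move=> ns; have [m ->] : exists m, s = (n + m).+1.
  by exists (s - n.+1)%N; rewrite -addSn subnKC.
rewrite weightV /Xcoef /shiftcoef !mul1r.
have -> : ((n + m).+1 - n.+1 = m)%N by lia.
have -> : ((n + m).+2 - n.+1 = m.+1)%N by lia.
have -> : - ((n + m).+1%:Z - 1 - 2 * n%:Z) = n%:Z - m%:Z by lia.
have -> : n%:Z - (n + m).+1%:Z = - m.+1%:Z by lia.
rewrite /Defs.qint expfzDr ?q_neq0 // -!exprnN -!exprnP !exprS.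
have := q_sqr_sub1_neq0 R hp; have q0 := q_neq0 R p.
have: q ^+ n != 0 by rewrite expf_neq0.
have: q ^+ m != 0 by rewrite expf_neq0.
move: (q ^+ n) (q ^+ m) (Defs.q R p) q0 => A B z z0 B0 A0 zz.
by field; rewrite z0 A0 B0 zz.
Qed.

(** The component along [|n-1> (x) |1>] of the same eigenvector equation. *)
Lemma offdiag_coef n : (n < s)%N ->
  q^-1 * ecoef false s n * ((weight false s n)^-1 + shiftcoef s n)
  = shiftcoef s n * d1 n.
Proof.
move=> ns; have [m ->] : exists m, s = (n + m).+1.
  by exists (s - n.+1)%N; rewrite -addSn subnKC.
rewrite weightV /Xcoef /shiftcoef !mul1r.
have -> : ((n + m).+1 - n = m.+1)%N by lia.
have -> : ((n + m).+2 - n.+1 = m.+1)%N by lia.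
have -> : - ((n + m).+1%:Z - 1 - 2 * n%:Z) = n%:Z - m%:Z by lia.
have -> : n%:Z - (n + m).+1%:Z = - m.+1%:Z by lia.
rewrite /Defs.qint expfzDr ?q_neq0 // -!exprnN -!exprnP !exprS.
have := q_sqr_sub1_neq0 R hp; have q0 := q_neq0 R p.
have: q ^+ n != 0 by rewrite expf_neq0.
have: q ^+ m != 0 by rewrite expf_neq0.
move: (q ^+ n) (q ^+ m) (Defs.q R p) q0 => A B z z0 B0 A0 zz.
by field; rewrite z0 A0 B0 zz.
Qed.

(** The eigenvalue on [|n> (x) |1>] modulo these eigenvectors is that of [|n>] in X(s-1). *)
Lemma d2_coef n : (n.+1 < s)%N ->
  q^-1 * ecoef false s n.+1 - shiftcoef s n.+1 = d2 n.
Proof.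
move=> ns; have [m ->] : exists m, s = (n + m).+2.
  by exists (s - n.+2)%N; rewrite -2!addSn subnKC.
rewrite /Xcoef /shiftcoef !mul1r.
have -> : ((n + m).+2 - n.+1 = m.+1)%N by lia.
have -> : ((n + m).+2.-1 - n.+1 = m)%N by lia.
have -> : n.+1%:Z - (n + m).+2%:Z = - m.+1%:Z by lia.
rewrite /Defs.qint -!exprnN !exprS.
have := q_sqr_sub1_neq0 R hp; have q0 := q_neq0 R p.
have: q ^+ n != 0 by rewrite expf_neq0.
have: q ^+ m != 0 by rewrite expf_neq0.
move: (q ^+ n) (q ^+ m) (Defs.q R p) q0 => A B z z0 B0 A0 zz.
by field; rewrite z0 A0 B0 zz.
Qed.

Lemma F_shiftmx_ket n : (n < s)%N -> F *m S *m ket s n = shiftcoef s n *: ket s n.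
Proof.
move=> ns; rewrite -mulmxA shiftmx_ket // -scalemxAr.
case: n ns => [|n] ns /=; first by rewrite /shiftcoef qint0 mulr0 !scale0r.
by rewrite X_F_ket // ltnW.
Qed.

Lemma EF_ket n : (n < s)%N -> E *m F *m ket s n = ecoef false s n.+1 *: ket s n.
Proof.
by move=> ns; rewrite X_EF (@diag_ket s (fun n => (-1) ^+ false * qint n.+1 * qint (s - n.+1))).
Qed.

(** [D1] is the action of [EF] on the stable subspace, [D2] that on the quotient. *)
Definition D1 : 'M[C]_s := invmx K + q *: (E *m F) + F *m S.
Definition D2 : 'M[C]_s := q^-1 *: (E *m F) - S *m F.

Lemma D1_diag : D1 = diag_mx (\row_(n < s) d1 n).
Proof.
apply: ket_inj => n ns; rewrite (@diag_ket s d1) !mulmxDl -scalemxAl.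
by rewrite invK_ket // EF_ket // F_shiftmx_ket // scalerA -!scalerDl d1_coef.
Qed.

Lemma D2_diag : D2 = diag_mx (\row_(n < s) d2 n).
Proof.
apply: ket_inj => n ns; rewrite (@diag_ket s d2) mulmxBl -scalemxAl EF_ket //.
rewrite scalerA -mulmxA X_F_ket //; have [ns'|sn] := ltnP n.+1 s.
  by rewrite shiftmx_ket //= -scalerBl d2_coef.
(* For the last index [n = s - 1] the vector [F|n>] is zero, and both coefficients vanish because
   they contain [qint 0]. *)
rewrite (ket_eq0 R sn) mulmx0 subr0; congr (_ *: _).
have sn1 : (s - n.+1 = 0)%N by lia.
have sn2 : (s.-1 - n.+1 = 0)%N by lia.
by rewrite /Xcoef sn1 sn2 qint0 !mulr0.
Qed.

Lemma offdiag : q^-1 *: (E *m invmx K + E *m F *m S) = S *m D1.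
Proof.
rewrite D1_diag; apply: ket_inj => n ns.
rewrite -[in RHS]mulmxA (@diag_ket s d1) -scalemxAr shiftmx_ket // scalerA.
rewrite -scalemxAl mulmxDl -!mulmxA invK_ket // (mulmxA F) F_shiftmx_ket //.
rewrite -!scalemxAr X_E_ket // !scalerA -scalerDl scalerA mulrC -mulrDl.
by rewrite [in RHS]mulrC -offdiag_coef //; congr (_ *: _); ring.
Qed.

Lemma K_shiftmx : q^-1 *: (K *m S) = q *: (S *m K).
Proof.
apply: ket_inj => n ns; rewrite -2!scalemxAl -2!mulmxA (shiftmx_ket ns) (X_K_ket _ _ _ ns).
rewrite -2!scalemxAr (shiftmx_ket ns); case: n ns => [|n] ns /=.
  by rewrite /shiftcoef qint0 mulr0 !scale0r !(scaler0, mulmx0).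
rewrite (X_K_ket _ _ _ (ltnW ns)) weightS !scalerA; congr (_ *: _).
by have q0 := q_neq0 R p; field.
Qed.

End TensorWithX2.

Lemma ket2_orth : [/\ e0^T *m e0 = 1%:M, e1^T *m e1 = 1%:M, e0^T *m e1 = 0,
  e1^T *m e0 = 0 & e0 *m e0^T + e1 *m e1^T = 1%:M].
Proof.
split; apply/matrixP => i j; rewrite ?ord1 !mxE ?big_ord_recl !big_ord0 ?mxE /=;
  rewrite ?(mulr1, mulr0, mul0r, addr0, add0r, mxE) //.
by case: i => -[|[|]] // hi; case: j => -[|[|]] // hj; rewrite /= ?(mulr1, mulr0, addr0, add0r).
Qed.

(** Two strings of [s] eigenvalue pairs each, following the formulas for X(s+1) and X(s-1) but not
    their dimensions; [X_mul2] and [X_mul2p] regroup the terms. *)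
Lemma moment_tens2 i j s : (s <= p)%N ->
  moment i j (tens hp (Xmod false s) (Xmod false 2))
  = \sum_(n < s) ecoef false s.+1 n.+1 ^+ i * weight false s.+1 n ^+ j
    + \sum_(n < s) ecoef false s.-1 n.+1 ^+ i * weight false s.-1 n ^+ j.
Proof.
move=> sp; rewrite /moment (XmodE R false sp) (XmodE R false hp) /=.
have [E20 E21] := X_E2_ket; have [F20 F21] := X_F2_ket; have [K20 K21] := X_K2_ket.
have [o00 o11 o01 o10 oo] := ket2_orth.
have Kdiag c t : (forall n, (n < s)%N -> c * weight false s n = weight false t n) ->
    c *: X_K R p false s = diag_mx (\row_(n < s) weight false t n).
  move=> cw; apply: ket_inj => n ns.
  by rewrite -scalemxAl X_K_ket // scalerA cw // (@diag_ket s (weight false t)).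
have K1E : q *: X_K R p false s = diag_mx (\row_(n < s) weight false s.+1 n).
  apply: Kdiag => n _; rewrite /Xweight !mul1r -[X in X * _]expr1z -expfzDr ?q_neq0 //.
  by congr (_ ^ _); rewrite intS; ring.
have K2E : q^-1 *: X_K R p false s = diag_mx (\row_(n < s) weight false s.-1 n).
  apply: Kdiag => n ns; rewrite /Xweight !mul1r -[q^-1]/(q ^ (-1)) -expfzDr ?q_neq0 //.
  by congr (_ ^ _); case: (s) ns => // m _; rewrite intS /=; ring.
apply: etrans (mxtrace_tens2 i j o00 o11 o01 o10 oo E20 E21 F20 F21 K20 K21
  (offdiag s) (K_shiftmx s) (D1_diag s) (D2_diag s) K1E K2E) _.
by congr (_ + _); apply: eq_bigr => n _; rewrite 2!mxE.
Qed.

End TensorMoments.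

(** * Chebyshev polynomials *)

Section FusionSums.

Definition fusion_sum (V : zmodType) (f : nat -> V) (s t : nat) : V :=
  let d := absz (s%:Z - t%:Z) in
  \sum_(d.+1 <= u < s + t | ~~ odd (u - d.+1)) f u.

(** The difference [|s - t|] is unchanged, and of the two new indices [s + t] and [s + t + 1] only
    the second has the right parity. *)
Lemma fusion_sumSS (V : zmodType) (f : nat -> V) s t :
  fusion_sum f s.+1 t.+1 = fusion_sum f s t + f (s + t).+1.
Proof.
rewrite /fusion_sum (_ : s.+1%:Z - t.+1%:Z = s%:Z - t%:Z); last by lia.
have dst : (`|s%:Z - t%:Z| <= s + t)%N by lia.
have par : odd (s + t - `|s%:Z - t%:Z|) = false by lia.
move: `|_|%N dst par => d dst par; rewrite addSn addnS big_mkcond big_nat_recr //=.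
rewrite subSS par /= -big_mkcond; congr (_ + _).
have [ds|sd] := ltnP d (s + t)%N; last by rewrite !big_geq // ltnW.
rewrite [LHS]big_mkcond big_nat_recr //= -big_mkcond.
have -> : odd (s + t - d.+1) by lia.
by rewrite addr0.
Qed.

Lemma fusion_sum0l (V : zmodType) (f : nat -> V) t : fusion_sum f 0 t = 0.
Proof. by rewrite /fusion_sum big_geq //; lia. Qed.

Lemma fusion_sum0r (V : zmodType) (f : nat -> V) s : fusion_sum f s 0 = 0.
Proof. by rewrite /fusion_sum big_geq //; lia. Qed.

Variables (A : pzRingType) (x : A).

(* Indexed so that cheb (2 cos t) n = sin(n t) / sin t. *)
Fixpoint cheb (n : nat) : A :=
  match n with
  | 0 => 0
  | n1.+1 => match n1 with 0 => 1 | n2.+1 => cheb n1 * x - cheb n2 end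
  end.

Lemma chebSS n : cheb n.+2 = cheb n.+1 * x - cheb n. Proof. by []. Qed.

(** Both sides satisfy the Chebyshev recurrence in [t], so the induction carries two consecutive
    values. The identity has the shape of [fusion_sumSS]. *)
Lemma chebM s t : cheb s.+1 * cheb t.+1 = cheb s * cheb t + cheb (s + t).+1.
Proof.
suff: cheb s.+1 * cheb t.+1 = cheb s * cheb t + cheb (s + t).+1 /\
      cheb s.+1 * cheb t.+2 = cheb s * cheb t.+1 + cheb (s + t.+1).+1 by case.
elim: t => [|t [IH0 IH1]].
  by rewrite addn0 addn1 mulr0 add0r !mulr1 chebSS mul1r subr0 addrC subrK.
split=> //; rewrite [cheb t.+3]chebSS mulrBr mulrA IH1 IH0 mulrDl -mulrA opprD.
by rewrite addrACA -mulrBr -chebSS !addnS -chebSS.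
Qed.

Lemma chebM_sum s t : cheb s * cheb t = fusion_sum cheb s t.
Proof.
elim: s t => [|s IH] [|t]; rewrite ?fusion_sum0l ?fusion_sum0r ?mul0r ?mulr0 //.
by rewrite chebM IH fusion_sumSS.
Qed.

(* The hypothesis says that U_{p+1} - U_{p-1} = 2 e, the case k = 1. *)
Lemma cheb_reflect (e : A) p : (0 < p)%N -> GRing.comm e x ->
  cheb p * x = cheb p.-1 *+ 2 + e *+ 2 ->
  forall k, (k <= p)%N -> cheb (p + k) = cheb (p - k) + (e * cheb k) *+ 2.
Proof.
case: p => // p _ ex; rewrite /= => px k.
suff: (k <= p.+1)%N -> cheb (p.+1 + k) = cheb (p.+1 - k) + (e * cheb k) *+ 2 /\
  ((k < p.+1)%N -> cheb (p.+1 + k.+1) = cheb (p.+1 - k.+1) + (e * cheb k.+1) *+ 2).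
  by move=> H /H[].
elim: k => [_|k IH kp].
  rewrite addn0 subn0 mulr0 mul0rn addr0; split=> // _.
  by rewrite addn1 chebSS px subSS subn0 mulr1 mulr2n addrAC addrK.
have [IH0 /(_ kp) IH1] := IH (ltnW kp); split=> // kp'.
rewrite !addnS chebSS -!addnS IH1 IH0 mulrDl mulrnAl -mulrA [cheb k.+2]chebSS.
rewrite mulrBr mulrnBl opprD addrACA; congr (_ + _).
rewrite (_ : p.+1 - k = (p.+1 - k.+2).+2)%N; last by lia.
by rewrite (_ : p.+1 - k.+1 = (p.+1 - k.+2).+1)%N ?chebSS ?subKr //; lia.
Qed.

End FusionSums.

(** * The fusion rules *)

Section FusionRules.
Local Open Scope complex_scope.
Local Open Scope quotient_scope.
Variables (R : realType) (p : nat) (hp : (1 < p)%N).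
Local Notation q := (q R p).
Local Notation qint := (qint R p).
Local Notation Umod := (Umod R p).
Local Notation Xmod := (Xmod R p).
Local Notation weight := (Xweight R p).
Local Notation ecoef := (Xcoef R p).
Local Notation cl := (K0class hp).
Local Notation XX a s := (cl (Xmod a s)).

Lemma K0class_mul (M N : Umod) : cl M * cl N = cl (tens hp M N).
Proof. by rewrite -[LHS]/(K0mul _ _) -pi_K0mul FGmul_gen. Qed.

Lemma X_mul1l a b s : (s <= p)%N -> XX a 1 * XX b s = XX (a (+) b) s.
Proof.
move=> sp; apply: K0_eqP => i j.
by rewrite K0class_mul !K0moment_class moment_tens1l.
Qed.

Lemma X_mul1r a b s : (s <= p)%N -> XX b s * XX a 1 = XX (a (+) b) s.
Proof.
move=> sp; apply: K0_eqP => i j.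
by rewrite K0class_mul !K0moment_class moment_tens1r.
Qed.

Lemma X_one : XX false 1 = 1.
Proof.
apply: K0_eqP => i j; rewrite !K0moment_class moment_Xmod ?(ltnW hp) //.
rewrite big_ord_recl big_ord0 addr0 /moment /= mul0mx weight0 mulr1 expr1n mulr1.
rewrite /Xcoef subnn qint0 mulr0 expr1n mulmx1; case: i => [|i].
  by rewrite !expr0 mxtrace1.
by rewrite !expr0n mxtrace0.
Qed.

Lemma X_zero a : XX a 0 = 0.
Proof. by apply: K0class_dim0; rewrite dim_Xmod. Qed.

Lemma ecoef_last a s : ecoef a s s.+1 = 0.
Proof. by rewrite /Xcoef (_ : s - s.+1 = 0)%N ?qint0 ?mulr0 //; lia. Qed.

Lemma ecoef_top a s : ecoef a s s = 0.
Proof. by rewrite /Xcoef subnn qint0 mulr0. Qed.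

(** The last pair of the second sum in [moment_tens2], namely [0] for [EF] and [q^(-s-1)] for [K],
    is the lowest weight pair missing from the first. *)
Lemma X_mul2 s : (s.+1 < p)%N ->
  XX false s.+1 * XX false 2 = XX false s.+2 + XX false s.
Proof.
move=> sp; apply: K0_eqP => i j; rewrite K0class_mul raddfD /= !K0moment_class.
rewrite moment_tens2 1?ltnW // !moment_Xmod ?(ltnW (ltnW sp)) //=.
rewrite [in RHS]big_ord_recr [X in _ + X = _]big_ord_recr /= -addrA; congr (_ + _).
rewrite addrC ecoef_last ecoef_top; congr (_ * _ ^+ _ + _).
by rewrite /Xweight; congr (_ * _ ^ _); lia.
Qed.

Lemma qint_compl n : (n <= p)%N -> qint (p - n) = qint n.
Proof.
move=> np; rewrite /Defs.qint; congr (_ / _).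
have qpn : q ^+ (p - n) = - q ^- n.
  apply: (mulIf (expf_neq0 n (q_neq0 R p))).
  by rewrite -exprD subnK // q_powp // mulNr mulVf // expf_neq0 ?q_neq0.
by rewrite qpn invrN invrK opprK addrC.
Qed.

Lemma qint_p : qint p = 0.
Proof. by rewrite -(qint_compl (leqnn p)) subnn qint0. Qed.

Lemma X_mul2p : XX false p * XX false 2 = XX false p.-1 *+ 2 + XX true 1 *+ 2.
Proof.
have p0 := ltnW hp; apply: K0_eqP => i j.
rewrite K0class_mul raddfD !raddfMn /= !K0moment_class moment_tens2 //.
rewrite !moment_Xmod ?leq_pred // big_ord_recl big_ord0 addr0.
set f := fun a s n => ecoef a s n.+1 ^+ i * weight a s n ^+ j.
(* In the formulas for [p + 1] the term [n = 0] is the pair [(0, -1)] of X^-(1), and the others are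
   those of X(p-1) shifted by one, since [[p - n] = [n]]. *)
have -> : \sum_(n < p) ecoef false p.+1 n.+1 ^+ i * weight false p.+1 n ^+ j
    = f true 1%N 0%N + \sum_(n < p.-1) f false p.-1 n.
  rewrite -(big_mkord xpredT (f false p.+1)) big_ltn // big_add1 big_mkord.
  congr (_ + _).
    rewrite /f; congr (_ ^+ _ * _ ^+ _).
      by rewrite ecoef_top /Xcoef subSS subn0 qint_p mulr0.
    by rewrite !weight0 mul1r mulr1 q_powp.
  apply: eq_bigr => n _; have np := ltn_ord n; rewrite /f; congr (_ ^+ _ * _ ^+ _).
    have c1 : qint n.+2 = qint (p.-1 - n.+1).
      by rewrite -qint_compl; [congr qint; lia|lia].
    have c2 : qint (p.+1 - n.+2) = qint n.+1.
      by rewrite -[RHS]qint_compl; [congr qint; lia|lia].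
    by rewrite /Xcoef !mul1r c1 c2 mulrC.
  by rewrite /Xweight; congr (_ * _ ^ _); lia.
(* In the formulas for X(p-1) the surplus term [n = p - 1] is again the pair [(0, -1)] of X^-(1). *)
have -> : \sum_(n < p) ecoef false p.-1 n.+1 ^+ i * weight false p.-1 n ^+ j
    = \sum_(n < p.-1) f false p.-1 n + f true 1%N 0%N.
  rewrite -(big_mkord xpredT (f false p.-1)) -[in LHS](prednK p0) big_nat_recr //= big_mkord.
  congr (_ + _); rewrite /f; congr (_ ^+ _ * _ ^+ _).
    by rewrite ecoef_last ecoef_top.
  rewrite weight0 mulr1 expr1 -(q_powp R hp) /Xweight mul1r.
  rewrite -[LHS]mulr1 -(q_pow2p R p) !exprnP -expfzDr ?q_neq0 //; congr (_ ^ _); lia.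
by rewrite addrACA [X in X + _]addrC addrACA -!mulr2n addrC.
Qed.

Local Notation U := (cheb (XX false 2)).

(** [X_mul2] is the Chebyshev recurrence, with the zero module as X(0) and the unit as X(1). *)
Lemma X_cheb s : (s <= p)%N -> XX false s = U s.
Proof.
suff H : (s <= p)%N -> XX false s = U s /\ ((s < p)%N -> XX false s.+1 = U s.+1).
  by move=> /H[].
elim: s => [_|s IH sp].
  by split=> [|_]; [rewrite X_zero | rewrite X_one].
have [IH0 /(_ sp) IH1] := IH (ltnW sp); split=> // sp'.
by rewrite chebSS -IH1 -IH0 X_mul2 // addrK.
Qed.

Lemma tilde_cheb a t : (0 < t < 2 * p)%N ->
  tilde p (fun b s => XX b s) a t = XX a 1 * U t.
Proof.
case/andP=> t0 t2p; rewrite /tilde; case: leqP => tp.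
  by rewrite -X_cheb // X_mul1l // addbF.
have [k kp tE] : exists2 k, (k < p)%N & t = (p + k)%N.
  by exists (t - p)%N; lia.
have p0 := ltnW hp.
have pk : (2 * p - (p + k) = p - k)%N by lia.
rewrite tE pk addKn.
(* Above [p], the second case of [tilde] is the reflection formula with [e] the class of X^-(1); its
   hypothesis is [X_mul2p]. *)
rewrite (@cheb_reflect _ _ (XX true 1) p p0); last exact: ltnW.
- rewrite -!X_cheb ?leq_subr ?(ltnW kp) // X_mul1l ?(ltnW kp) // mulrDr.
  rewrite X_mul1l ?leq_subr // addbF mulrnAr X_mul1l ?(ltnW kp) //.
  by rewrite addbF addbT.
- by rewrite /GRing.comm X_mul1l // X_mul1r.
- by rewrite -!X_cheb ?leq_pred // X_mul2p.
Qed.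

(** Each factor is a sign class X^alpha(1) times a Chebyshev value; the sign classes are moved to
    the front and [chebM_sum] expands the rest. *)
Lemma X_mul a a' s s' : (0 < s <= p)%N -> (0 < s' <= p)%N ->
  XX a s * XX a' s' = fusion_rhs p (fun b t => XX b t) a s a' s'.
Proof.
move=> /andP[s0 sp] /andP[s0' sp'].
rewrite -[a in LHS]addbF -X_mul1l // -[a' in LHS]addbF -(X_mul1l a' false sp').
rewrite -mulrA (mulrA (XX false s)) X_mul1r // -(X_mul1l a' false sp) -mulrA mulrA.
rewrite X_mul1l ?(ltnW hp) // (X_cheb sp) (X_cheb sp') chebM_sum mulr_sumr /fusion_rhs.
rewrite big_nat_cond [RHS]big_nat_cond; apply: eq_bigr => t /andP[/andP[t0 tss] _].
by rewrite tilde_cheb //; lia.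
Qed.

Lemma lincomb_fusion_rhs a a' s s' : (0 < s <= p)%N -> (0 < s' <= p)%N ->
  lincomb R hp (fusion_rhs p (chi p) a s a' s') = XX a s * XX a' s'.
Proof.
move=> sp sp'; rewrite X_mul // /fusion_rhs raddf_sum /=.
rewrite big_nat_cond [RHS]big_nat_cond; apply: eq_bigr => t /andP[/andP[t0 tss] _].
rewrite /tilde; case: leqP => tp; first by rewrite chi_lincomb //; lia.
by rewrite raddfD raddfMn /= !chi_lincomb //; lia.
Qed.

Lemma lincomb_mul : {morph lincomb R hp : x y / fusion_mul x y >-> x * y}.
Proof.
move=> x y; rewrite /fusion_mul raddf_sum big_distrl; apply: eq_bigr => i _ /=.
rewrite raddf_sum big_distrr; apply: eq_bigr => j _ /=.
by rewrite raddfMz /= lincomb_fusion_rhs ?ltn_ord // mulrzAl mulrzAr mulrzA mulrzAC.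
Qed.

Lemma lincomb_bij : bijective (lincomb R hp).
Proof.
have [g gK] := choice (@lincomb_surj R p hp).
exists g => x; last exact/esym/gK.
apply: (@lincomb_inj R p hp); exact/esym/gK.
Qed.

End FusionRules.

Theorem theorem1p2 (R : realType) (p : nat) (hp : (1 < p)%N) :
  [/\ (forall (a : bool) (s : nat), (0 < s <= p)%N -> irreducible (Xmod R p a s)),
      (forall M : Umod R p, irreducible M ->
         exists! x : bool * 'I_p, Uiso M (Xmod R p x.1 x.2.+1)),
      (forall x : K0 R hp, exists! c : {ffun bool * 'I_p -> int},
         x = \sum_(i : bool * 'I_p) K0class hp (Xmod R p i.1 i.2.+1) *~ c i),
      (forall (a a' : bool) (s s' : nat), (0 < s <= p)%N -> (0 < s' <= p)%N ->
         K0class hp (Xmod R p a s) * K0class hp (Xmod R p a' s')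
         = fusion_rhs p (fun b t => K0class hp (Xmod R p b t)) a s a' s')
    & exists phi : {additive fusion p -> K0 R hp},
        [/\ bijective phi,
            phi (chi p false 1) = 1,
            (forall (a : bool) (s : nat), (0 < s <= p)%N ->
               phi (chi p a s) = K0class hp (Xmod R p a s))
          & {morph phi : x y / fusion_mul x y >-> x * y}]].
Proof.
split.
- exact: Xmod_irreducible.
- exact: irreducible_Xmod.
- move=> x; have [c cE] := lincomb_surj x; exists c; split=> // d dE.
  by apply: (@lincomb_inj R p hp); rewrite -cE dE.
- exact: X_mul.
exists (lincomb R hp); split.
- exact: lincomb_bij.
- by rewrite /= (chi_lincomb R hp) ?X_one //= ltnW.
- exact: chi_lincomb.
- exact: lincomb_mul.
Qed.
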